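(* Let $G$ be a group and let $\Gamma$ be a finitely generated group of automorphisms of $G$ (that is, a finitely generated subgroup of $\mathrm{Aut}\,G$) such that the external semidirect product $E=G\rtimes\Gamma$ is locally nilpotent. Assume that $G$ has a finite subgroup $H$ which is a $C_{\mathrm{Aut}\,G}(\Gamma)$-basis of $G$. Then $E$ is finite.
   Context: For a set $\Delta$ of endomorphisms of a group $G$, a subset $X$ of $G$ is a $\Delta$-basis of $G$ if any two elements of $\Delta$ having the same restriction to $X$ are equal. Here $C_{\mathrm{Aut}\,G}(\Gamma)$ is the centralizer of $\Gamma$ in $\mathrm{Aut}\,G$; thus $H$ is a $C_{\mathrm{Aut}\,G}(\Gamma)$-basis if and only if the only automorphism of $G$ that commutes with every element of $\Gamma$ and fixes every element of $H$ is the identity. *)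

(* Defs.v *)
From HB Require Import structures.
From mathcomp Require Import all_boot monoid.
From mathcomp Require Import boolp classical_sets functions cardinality.

Set Implicit Arguments.
Unset Strict Implicit.
Unset Printing Implicit Defensive.

Local Open Scope classical_set_scope.
Local Open Scope group_scope.

Record subgroup (G : groupType) := Subgroup {
  subgroup_set :> set G;
  subgroup_closed : group_closed [in subgroup_set]
}.

Record subgroup_type (G : groupType) (H : subgroup G) := SubgroupElt {
  subgroup_val :> G;
  subgroup_valP : subgroup_val \in subgroup_set H
}.

Section SubgroupType.
Context {G : groupType} {H : subgroup G}.

HB.instance Definition _ :=
  [isSub of subgroup_type H for @subgroup_val G H].
HB.instance Definition _ := [Choice of subgroup_type H by <:].
HB.instance Definition _ := SubChoice_isSubGroup.Build G
  [in subgroup_set H] (subgroup_type H) (subgroup_closed H).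

End SubgroupType.

Definition generated (G : groupType) (X : set G) : set G :=
  smallest (fun A : set G => group_closed [in A]) X.

Definition finitely_generated (G : groupType) (H : subgroup G) : Prop :=
  exists2 X : set G, finite_set X & generated X = H.

Fixpoint lower_central (G : groupType) (H : subgroup G) (n : nat) : set G :=
  if n is m.+1 then
    generated [set z | exists x y : G,
      [/\ lower_central H m x, (H : set G) y & z = [~ x, y]]]
  else H.

Definition nilpotent (G : groupType) (H : subgroup G) : Prop :=
  exists n, lower_central H n = [set 1].

Definition locally_nilpotent (G : groupType) : Prop :=
  forall H : subgroup G, finitely_generated H -> nilpotent H.

Record aut (G : groupType) := Aut {
  aut_fun :> {multiplicative G -> G};
  aut_bij : bijective aut_fun
}.

HB.instance Definition _ (G : groupType) := gen_eqMixin (aut G).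
HB.instance Definition _ (G : groupType) := gen_choiceMixin (aut G).

Lemma multiplicativeP (G H : groupType) (f g : {multiplicative G -> H}) :
  f =1 g -> f = g.
Proof.
case: f g => f [[fM]] [g [[gM]]] /= /funext fg; rewrite fg in fM *.
by rewrite (Prop_irrelevance fM gM).
Qed.

Lemma autP (G : groupType) (f g : aut G) : f =1 g -> f = g.
Proof.
case: f g => f fB [g gB] /= /multiplicativeP fg; rewrite fg in fB *.
by rewrite (Prop_irrelevance fB gB).
Qed.

Section AutGroup.
Context {G : groupType}.
Implicit Types f g h : aut G.

Definition aut_one : aut G := @Aut G idfun (Bijective (frefl _) (frefl _)).

Definition aut_mul f g : aut G :=
  @Aut G (aut_fun f \o aut_fun g) (bij_comp (aut_bij f) (aut_bij g)).

Lemma aut_inv_exists f : exists g, cancel g f /\ cancel f g.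
Proof.
have [k fK kK] := aut_bij f.
have kM : {morph k : x y / x * y}.
  by move=> x y; apply: (bij_inj (aut_bij f)); rewrite gmulfM !kK.
pose k' : {multiplicative G -> G} :=
  HB.pack k (isMultiplicative.Build G G k kM).
have k'B : bijective k' by exists f.
by exists (Aut k'B).
Qed.

Definition aut_inv f : aut G := sval (cid (aut_inv_exists f)).

Lemma aut_invK f : cancel (aut_inv f) f.
Proof. by rewrite /aut_inv; case: cid => g []. Qed.

Lemma autK f : cancel f (aut_inv f).
Proof. by rewrite /aut_inv; case: cid => g []. Qed.

Fact aut_mulA : associative aut_mul. Proof. by move=> f g h; apply: autP. Qed.
Fact aut_mul1g : left_id aut_one aut_mul. Proof. by move=> f; apply: autP. Qed.
Fact aut_mulg1 : right_id aut_one aut_mul. Proof. by move=> f; apply: autP. Qed.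
Fact aut_mulVg : left_inverse aut_one aut_inv aut_mul.
Proof. by move=> f; apply: autP => x; apply: autK. Qed.
Fact aut_mulgV : right_inverse aut_one aut_inv aut_mul.
Proof. by move=> f; apply: autP => x; apply: aut_invK. Qed.

HB.instance Definition _ := isGroup.Build (aut G)
  aut_mulA aut_mul1g aut_mulg1 aut_mulVg aut_mulgV.

End AutGroup.

(* Automorphisms act on the left, [(f * g) x = f (g x)]; accordingly the
   product in [N ><| K] is [(x, a) (y, b) = (x * phi a y, a * b)]. *)
Record sdprod (N K : groupType) (phi : {multiplicative K -> aut N}) :=
  SDProd { sd_left : N; sd_right : K }.

Section SDProdGroup.
Context {N K : groupType} {phi : {multiplicative K -> aut N}}.
Local Notation E := (sdprod phi).
Implicit Types u v w : E.

HB.instance Definition _ := gen_eqMixin E.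
HB.instance Definition _ := gen_choiceMixin E.

Definition sd_one : E := SDProd phi 1 1.

Definition sd_mul u v : E :=
  SDProd phi (sd_left u * phi (sd_right u) (sd_left v))
    (sd_right u * sd_right v).

Definition sd_inv u : E :=
  SDProd phi (phi (sd_right u)^-1 (sd_left u)^-1) (sd_right u)^-1.

Fact sd_phi1 x : phi 1 x = x.
Proof.
suff -> : phi 1 = 1 by [].
by apply: (@mulgI _ (phi 1)); rewrite -gmulfM !mulg1.
Qed.

Fact sd_phiM a b x : phi (a * b) x = phi a (phi b x).
Proof. by rewrite gmulfM. Qed.

Fact sd_aut1 (f : aut N) : f 1 = 1.
Proof. by apply: (@mulgI _ (f 1)); rewrite -gmulfM !mulg1. Qed.

Fact sd_mulA : associative sd_mul.
Proof.
by move=> [x a] [y b] [z c]; rewrite /sd_mul /= gmulfM sd_phiM !mulgA.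
Qed.

Fact sd_mul1g : left_id sd_one sd_mul.
Proof. by move=> [x a]; rewrite /sd_mul /= sd_phi1 !mul1g. Qed.

Fact sd_mulg1 : right_id sd_one sd_mul.
Proof. by move=> [x a]; rewrite /sd_mul /= sd_aut1 !mulg1. Qed.

Fact sd_mulVg : left_inverse sd_one sd_inv sd_mul.
Proof. by move=> [x a]; rewrite /sd_mul /= -gmulfM !mulVg sd_aut1. Qed.

Fact sd_mulgV : right_inverse sd_one sd_inv sd_mul.
Proof. by move=> [x a]; rewrite /sd_mul /= -sd_phiM !mulgV sd_phi1 mulgV. Qed.

HB.instance Definition _ := isGroup.Build E
  sd_mulA sd_mul1g sd_mulg1 sd_mulVg sd_mulgV.

End SDProdGroup.

Definition semidirect (G : groupType) (Gam : subgroup (aut G)) : groupType :=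
  sdprod (val : {multiplicative subgroup_type Gam -> aut G}).

Definition delta_basis (G : groupType) (Delta : set {multiplicative G -> G})
    (X : set G) : Prop :=
  forall f g, Delta f -> Delta g -> {in X, f =1 g} -> f = g.

Definition aut_centralizer (G : groupType) (Gam : set (aut G)) : set (aut G) :=
  [set a | forall c, Gam c -> commute a c].

(* Main.v *)
(** Write E = G ><| Gam. A power of each central element of Gam commutes with
    the finite group H, hence is trivial by the basis hypothesis; so Gam is a
    finitely generated nilpotent torsion group and K = <H, Gam> is finite. Every
    automorphism of E that fixes K and is trivial modulo G is now the identity.
    Inner automorphisms show that Z = C_G(K) is central, and G / Z is torsion.
    For the finitely many primes p that divide the exponent of K and are orders
    of elements of Z, the automorphisms x |-> x c^(f x), with c in Z of order p
    and f : E -> Z/p killing K, show that E is generated by c, K, p-th powers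
    and commutators.

    Choose R normal with Z <= R <= G and E = KR such that K meets R in as few
    points as possible. If R had an element outside its centre A, then local
    nilpotency would give g in R outside A with g^p in A, [g, K] <= A and g
    commuting with the intersection of K and R, because r |-> [g, r] is an
    equivariant map to A[p] and R = <R^p, [R, E], Z>. The map kr |-> k r^g would
    then be a forbidden automorphism. So R is abelian, E is a finite group times
    a normal abelian subgroup B that is divisible by all relevant p, and a
    nontrivial automorphism of B that respects K exists unless B = 1: a power map
    on the divisible p-part of B, extended by averaging a retraction over K, or
    inversion if B is torsion-free at every relevant p. *)
From HB Require Import structures.
Require Import Defs.
From mathcomp Require Import all_boot monoid.
From mathcomp Require Import boolp classical_sets functions cardinality.

Set Implicit Arguments.
Unset Strict Implicit.
Unset Printing Implicit Defensive.

Local Open Scope classical_set_scope.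
Local Open Scope group_scope.

(** * Subgroups, commutators and torsion in locally nilpotent groups *)

(** A bare predicate, so that sets given by comprehension can be proved subgroups on the spot;
    [subgrpP] and [gen_subgroup] link it to the record [subgroup]. *)
Definition subgrp (E : groupType) (A : set E) : Prop :=
  [/\ A 1, forall x y, A x -> A y -> A (x * y) & forall x, A x -> A x^-1].

Definition normalized_by (E : groupType) (N : set E) (x : E) : Prop :=
  forall u, N u -> N (u ^ x).

Definition normal_in (E : groupType) (N : set E) : Prop :=
  forall x, normalized_by N x.

Section Subgroups.
Context {E : groupType}.
Implicit Types (A N X : set E) (x y u : E).

Lemma subgrpP A : group_closed [in A] <-> subgrp A.
Proof.
split=> [[A1 AF]|[A1 AM AV]].
  have {}A1 : A 1 by apply: set_mem.
  have {}AF x y : A x -> A y -> A (x / y).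
    by move=> Ax Ay; apply: set_mem; apply: AF; apply: mem_set.
  have AV x : A x -> A x^-1 by move=> Ax; rewrite -div1g; apply: AF.
  by split=> // x y Ax Ay; rewrite -[y]invgK; apply: AF => //; apply: AV.
split; first exact: mem_set.
by move=> x y /set_mem Ax /set_mem Ay; apply: mem_set; apply: AM => //; apply: AV.
Qed.

Lemma subgrpX A (sA : subgrp A) n x : A x -> A (x ^+ n).
Proof.
by case: sA => A1 AM _ Ax; elim: n => [|n IHn] //; rewrite expgS; apply: AM.
Qed.

Lemma subgrpJ A (sA : subgrp A) x y : A x -> A y -> A (x ^ y).
Proof. case: sA => _ AM AV Ax Ay; exact: AM (AV _ Ay) (AM _ _ Ax Ay). Qed.

Lemma subgrpR A (sA : subgrp A) x y : A x -> A y -> A [~ x, y].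
Proof.
by move=> Ax Ay; case: (sA) => _ AM AV; apply: AM (AV _ Ax) (subgrpJ sA _ _).
Qed.

Lemma subgrpI A N : subgrp A -> subgrp N -> subgrp (A `&` N).
Proof.
move=> [A1 AM AV] [N1 NM NV]; split=> [|x y [Ax Nx] [Ay Ny]|x [Ax Nx]].
- by split.
- by split; [apply: AM | apply: NM].
- by split; [apply: AV | apply: NV].
Qed.

Lemma subgrp1 : subgrp [set 1 : E].
Proof.
by split=> // [x y /= -> ->|x /= ->]; rewrite ?mulg1 ?invg1.
Qed.

Lemma subgrp_cent (P : E -> Prop) : subgrp [set x | forall y, P y -> commute y x].
Proof.
split=> [y _|x z cx cz y Py|x cx y Py]; first exact: commute1.
- by apply: commuteM; [apply: cx | apply: cz].
- by apply: commuteV; apply: cx.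
Qed.

Lemma gen_subgrp X : subgrp (generated X).
Proof.
split=> [A [/subgrpP[A1 _ _] _]|x y gx gy A [sA XA]|x gx A [sA XA]] //.
- have /subgrpP[_ AM _] := sA.
  by apply: AM; [apply: gx | apply: gy].
- have /subgrpP[_ _ AV] := sA.
  by apply: AV; apply: gx.
Qed.

Lemma sub_gen X : X `<=` generated X.
Proof. by move=> x Xx A [_]; apply. Qed.

Lemma gen_min X A : subgrp A -> X `<=` A -> generated X `<=` A.
Proof. by move=> /subgrpP sA XA x; apply. Qed.

Definition gen_subgroup X : subgroup E :=
  Subgroup (iffRL (subgrpP _) (gen_subgrp X)).

Lemma subgroupP (H : subgroup E) : subgrp H.
Proof. exact/subgrpP/subgroup_closed. Qed.

End Subgroups.

(** * Commutator calculus modulo a subgroup *)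

Section CommutatorsModulo.
Context {E : groupType} (N : set E) (sN : subgrp N).
Implicit Types x y c t : E.

Lemma commgMl x y z : [~ x * y, z] = [~ x, z] ^ y * [~ y, z].
Proof. by rewrite /commg /conjg !gnorm. Qed.

Lemma commgMr x y z : [~ x, y * z] = [~ x, z] * [~ x, y] ^ z.
Proof. by rewrite /commg /conjg !gnorm. Qed.

Lemma conjg_mulR x y : x ^ y = x * [~ x, y].
Proof. by rewrite /commg /conjg !gnorm. Qed.

Lemma commgX_mod t c n :
  normalized_by N t -> N [~ t, c] -> N [~ t ^+ n, c].
Proof.
move=> nt Ntc; case: (sN) => N1 NM _.
elim: n => [|n IHn]; first by rewrite comm1g.
by rewrite expgSr commgMl; apply: NM => //; apply: nt.
Qed.

(** Modulo [N], [[~ c, s]] commutes with [c], so taking commutators with [s] is multiplicative on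
    powers of [c]. The descents in [gen_expg] and [power_commutes] rest on this. *)
Lemma expg_comm_mod c s n :
    normalized_by N c -> normalized_by N [~ c, s] -> N [~ [~ c, s], c] ->
  N (([~ c, s] ^+ n)^-1 * [~ c ^+ n, s]).
Proof.
move=> nc nt Ntc; case: (sN) => N1 NM _.
elim: n => [|n IHn]; first by rewrite comm1g invg1 mulg1.
set t := [~ c, s] in nt Ntc IHn *.
have -> : (t ^+ n.+1)^-1 * [~ c ^+ n.+1, s] =
    ([~ t ^+ n, c] * ((t ^+ n)^-1 * [~ c ^+ n, s]) ^ c) ^ t.
  by rewrite !expgSr commgMl -/t /commg /conjg !gnorm.
by apply: (nt); apply: NM; [apply: commgX_mod | apply: nc].
Qed.

Lemma expgM_mod x y n :
    normalized_by N x -> normalized_by N y -> N [~ y, x] ->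
  N ((x ^+ n * y ^+ n)^-1 * (x * y) ^+ n).
Proof.
move=> nx ny Nyx; case: (sN) => N1 NM _.
elim: n => [|n IHn]; first by rewrite !expg0 !gnorm.
have -> : (x ^+ n.+1 * y ^+ n.+1)^-1 * (x * y) ^+ n.+1 =
    ([~ y ^+ n, x] * ((x ^+ n * y ^+ n)^-1 * (x * y) ^+ n) ^ x) ^ y.
  by rewrite !expgSr /commg /conjg !gnorm.
by apply: (ny); apply: NM; [apply: commgX_mod | apply: nx].
Qed.

End CommutatorsModulo.

Section LowerCentral.
Context {E : groupType} (H : subgroup E).
Local Notation L := (lower_central H).

Lemma lower_central_subgrp n : subgrp (L n).
Proof. by case: n => [|n]; [exact: subgroupP | exact: gen_subgrp]. Qed.

Lemma lower_central_comm n x y : L n x -> (H : set E) y -> L n.+1 [~ x, y].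
Proof. by move=> Lx Hy; apply: sub_gen; exists x, y. Qed.

Lemma lower_centralS n : L n.+1 `<=` L n.
Proof.
elim: n => [|n IHn]; apply: gen_min; try exact: lower_central_subgrp.
  by move=> _ [x [y [Hx Hy ->]]]; exact: (subgrpR (subgroupP H)).
by move=> _ [x [y [Hx Hy ->]]]; apply: lower_central_comm => //; apply: IHn.
Qed.

Lemma lower_central_sub n : L n `<=` H.
Proof. by elim: n => [|n IHn] x // /lower_centralS/IHn. Qed.

Lemma lower_central_normalized n y : (H : set E) y -> normalized_by (L n) y.
Proof.
move=> Hy x Lx; rewrite conjg_mulR; case: (lower_central_subgrp n) => _ LM _.
by apply: LM => //; apply: lower_centralS; apply: lower_central_comm.
Qed.

End LowerCentral.

(** * Local nilpotency: last elements, powers and torsion *)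

Section LocallyNilpotent.
Context {E : groupType} (Enil : locally_nilpotent E).
Implicit Types (S : seq E) (x y : E).

Lemma gen_seq_nilpotent S :
  exists n, lower_central (gen_subgroup [set` S]) n = [set 1].
Proof. by apply: Enil; exists [set` S] => //; apply: finite_seq. Qed.

(* Local nilpotency in the form used below: iterating [y |-> [~ y, s]] from a
   point outside [N] must leave a last point outside [N]. *)
Lemma last_outside S (M N : set E) x :
    N 1 -> (forall y s, M y -> s \in S -> M [~ y, s]) -> M x -> ~ N x ->
  exists y, [/\ M y, ~ N y & forall s, s \in S -> N [~ y, s]].
Proof.
move=> N1 MR Mx Nx; apply: contrapT => noy.
have step y : M y -> ~ N y -> exists2 s, s \in S & ~ N [~ y, s].
  move=> My Ny; apply: contrapT => nos; apply: noy; exists y; split=> // s Ss.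
  by apply: contrapT => Ns; apply: nos; exists s.
have [n Ln] := gen_seq_nilpotent (x :: S).
have genS s : s \in S -> generated [set` x :: S] s.
  by move=> Ss; apply: sub_gen; rewrite /= inE Ss orbT.
suff [y [Ly My Ny]] :
    exists y, [/\ lower_central (gen_subgroup [set` x :: S]) n y, M y & ~ N y].
  by move: Ly; rewrite Ln /= => y1; rewrite y1 in Ny.
elim: n {Ln} => [|n [y [Ly My Ny]]].
  by exists x; split=> //; apply: sub_gen; rewrite /= inE eqxx.
have [s Ss Nys] := step y My Ny.
exists [~ y, s]; split=> //; last exact: MR.
by apply: lower_central_comm => //; apply: genS.
Qed.

(** [e] selects the admissible exponents: all positive ones for torsion, powers of [p] for primary
    parts. Taking powers pushes an element one term down the lower central series of [<S>], up to a
    factor in the centralized subgroup [A]; nilpotency ends the descent in [A]. *)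
Lemma gen_expg (e : nat -> Prop) (A : set E) S :
    e 1%N -> (forall m n, e m -> e n -> e (m * n)%N) -> subgrp A ->
    (forall s a, s \in S -> A a -> commute a s) ->
    (forall s, s \in S -> exists2 n, e n & A (s ^+ n)) ->
  forall x, generated [set` S] x -> exists2 n, e n & A (x ^+ n).
Proof.
move=> e1 eM sA cAS AS; pose H := gen_subgroup [set` S].
have cA x a : generated [set` S] x -> A a -> commute a x.
  move=> Hx Aa; suff /(_ x Hx a Aa) :
      generated [set` S] `<=` [set x | forall a, A a -> commute a x] by [].
  by apply: gen_min => [|s Ss b Ab]; [apply: subgrp_cent | apply: cAS].
pose L := lower_central H; have sL := lower_central_subgrp H.
have [A1 AM AV] := sA.
(* [Q i] is a subgroup because [L i] is commutative modulo [L i.+1], so that the exponents of two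
   factors can be multiplied. *)
pose Q i := [set x | L i x /\ exists n, e n /\ exists2 a, A a & L i.+1 (x ^+ n * a)].
have sQ i : subgrp (Q i).
  have [Li1 LiM LiV] := sL i; have [LS1 LSM LSV] := sL i.+1.
  split.
  - split=> //; exists 1%N; split=> //; exists 1 => //.
    by rewrite expg1 mulg1.
  - move=> x y [Lx [n [en [a Aa Lxa]]]] [Ly [m [em [b Ab Lyb]]]].
    have Hx := lower_central_sub Lx; have Hy := lower_central_sub Ly.
    split; first exact: LiM.
    exists (n * m)%N; split; first exact: eM.
    exists (a ^+ m * b ^+ n); first by apply: AM; exact: (subgrpX sA).
    have [u Lu xyE] : exists2 u, L i.+1 u &
        (x * y) ^+ (n * m) = x ^+ (n * m) * y ^+ (n * m) * u.
      exists ((x ^+ (n * m) * y ^+ (n * m))^-1 * (x * y) ^+ (n * m)).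
        apply: (@expgM_mod _ (L i.+1)) => //.
        - exact: lower_central_normalized.
        - exact: lower_central_normalized.
        - exact: lower_central_comm.
      by rewrite mulVKg.
    have c1 : commute (a ^+ m) (y ^+ (n * m) * u).
      apply/commute_sym/commuteX/commute_sym/cA => //.
      have [_ gM _] := gen_subgrp [set` S]; apply: gM.
        exact: (subgrpX (gen_subgrp _) _ Hy).
      exact: (lower_central_sub Lu).
    have c2 : commute (b ^+ n) u.
      apply/commute_sym/commuteX/commute_sym/cA => //.
      exact: (lower_central_sub Lu).
    have -> : (x * y) ^+ (n * m) * (a ^+ m * b ^+ n) =
       (x ^+ n * a) ^+ m * ((y ^+ m * b) ^+ n * u).
      rewrite (expgMn _ (commute_sym (commuteX n (cA _ _ Hx Aa)))).
      rewrite (expgMn _ (commute_sym (commuteX m (cA _ _ Hy Ab)))).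
      rewrite xyE -!expgnA [(m * n)%N]mulnC -!mulgA; congr (_ * _).
      by rewrite [in RHS]c2 !mulgA -c1 !mulgA.
    by apply: (LSM); [|apply: LSM => //]; exact: (subgrpX (sL i.+1)).
  - move=> x [Lx [n [en [a Aa Lxa]]]]; have Hx := lower_central_sub Lx.
    split; first exact: LiV.
    exists n; split=> //; exists a^-1; first exact: AV.
    have -> : x^-1 ^+ n * a^-1 = (x ^+ n * a)^-1.
      by rewrite -(commuteX n (cA _ _ Hx Aa)) invgM expVgn.
    exact: LSV.
have LQ i : L i `<=` Q i.
  elim: i => [|i IHi]; apply: gen_min => //.
    move=> s Ss; split; first exact: sub_gen.
    have [n en An] := AS s Ss; exists n; split=> //; exists (s ^+ n)^-1; first exact: AV.
    by rewrite mulgV; case: (sL 1%N).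
  (* Modulo [L i.+2], [[~ x, y] ^+ n] is [[~ x ^+ n, y] = [~ x ^+ n * a, y]], because [a] commutes
     with [<S>]; so the exponent of [x] serves again. *)
  move=> _ [x [y [Lx Hy ->]]].
  have [_ [n [en [a Aa Lxa]]]] := IHi x Lx.
  split; first exact: lower_central_comm.
  exists n; split=> //; exists 1; rewrite ?mulg1 //.
  have Hx := lower_central_sub Lx.
  have Lxy : L i.+1 [~ x, y] by apply: lower_central_comm.
  have := lower_central_comm Lxa Hy.
  rewrite commgMl (_ : [~ a, y] = 1); last by apply/eqP/commgP/cA.
  have HR : (H : set E) [~ x ^+ n, y].
    exact: (subgrpR (gen_subgrp _) (subgrpX (gen_subgrp _) n Hx)).
  rewrite mulg1 (_ : _ ^ a = [~ x ^+ n, y]); last first.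
    by rewrite /conjg -(cA _ _ HR Aa) mulKg.
  have Hxy : (H : set E) [~ x, y] by exact: (subgrpR (gen_subgrp _)).
  have := @expg_comm_mod _ _ (sL i.+2) x y n (lower_central_normalized Hx)
    (lower_central_normalized Hxy) (lower_central_comm Lxy Hx).
  have [_ LM LV] := sL i.+2.
  move=> /LV L1 L2; have := LM _ _ L2 L1.
  by rewrite invgM invgK mulgA mulgV mul1g.
have [c Lc] := gen_seq_nilpotent S.
move=> x Hx.
suff [n en [a Aa]] : exists2 n, e n & exists2 a, A a & L c (x ^+ n * a).
  rewrite /L Lc /= => xa; exists n => //.
  by move/eqP: xa; rewrite mulg_eq1 => /eqP ->; apply: AV.
elim: c {Lc} => [|c [n en [a Aa /LQ[_ [m [em [b Ab]]]]]]].
  by exists 1%N => //; exists 1 => //; rewrite expg1 mulg1.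
rewrite (expgMn _ (commute_sym (commuteX n (cA _ _ Hx Aa)))) -expgnA -mulgA.
move=> Lx; exists (n * m)%N; first exact: eM.
by exists (a ^+ m * b) => //; apply: AM => //; exact: (subgrpX sA).
Qed.

Definition torsion x : Prop := exists2 n, (0 < n)%N & x ^+ n = 1.

Lemma gen_torsion S x :
  (forall s, s \in S -> torsion s) -> generated [set` S] x -> torsion x.
Proof.
move=> Stor; apply: (@gen_expg (fun n => 0 < n)%N [set 1]) => //.
- by move=> m n; rewrite muln_gt0 => -> ->.
- exact: subgrp1.
- by move=> s _ _ /= ->; apply/commute_sym/commute1.
Qed.

Lemma torsion_subgrp : subgrp torsion.
Proof.
split=> [|x y tx ty|x [n n0 xn]]; first by exists 1%N.
- have sS z : z \in [:: x; y] -> generated [set` [:: x; y]] z by exact: sub_gen.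
  apply: (@gen_torsion [:: x; y]).
    by move=> s; rewrite !inE => /orP[] /eqP ->.
  by case: (gen_subgrp [set` [:: x; y]]) => _ gM _; apply: gM;
    apply: sS; rewrite !inE eqxx ?orbT.
- by exists n => //; rewrite expVgn xn invg1.
Qed.

Lemma torsionJ x y : torsion x -> torsion (x ^ y).
Proof. by case=> n n0 xn; exists n; rewrite -?conjXg ?xn ?conj1g. Qed.

Lemma torsionR x y : torsion x -> torsion [~ x, y].
Proof.
move=> tx; case: torsion_subgrp => _ tM tV.
by apply: tM; [apply: tV | apply: torsionJ].
Qed.

Lemma torsionRr x y : torsion y -> torsion [~ x, y].
Proof.
by move=> ty; rewrite -invgR; case: torsion_subgrp => _ _; apply; apply: torsionR.
Qed.

Lemma common_exponent S (f : E -> E) : (forall s, s \in S -> torsion (f s)) ->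
  exists2 n, (0 < n)%N & forall s, s \in S -> f s ^+ n = 1.
Proof.
elim: S => [|s S IHS] Stor; first by exists 1%N.
have [|n n0 Sn] := IHS; first by move=> t St; apply: Stor; rewrite inE St orbT.
have [m m0 sm] : torsion (f s) by apply: Stor; rewrite inE eqxx.
exists (n * m)%N => [|t]; first by rewrite muln_gt0 n0.
rewrite inE => /orP[/eqP ->|St]; first by rewrite mulnC expgnA sm expg1n.
by rewrite expgnA Sn // expg1n.
Qed.

(** If all [[~ b ^+ n, s]] are killed by [m], then [[~ b ^+ (n * m), s]] is trivial modulo the next
    term of the lower central series of [<b, S>]; iterate down to the trivial term. *)
Lemma power_commutes b S : (forall s, s \in S -> torsion [~ b, s]) ->
  exists2 n, (0 < n)%N & forall s, s \in S -> commute (b ^+ n) s.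
Proof.
move=> Stor; pose H := gen_subgroup [set` b :: S].
have [c Lc] := gen_seq_nilpotent (b :: S).
have [Hb HS] : (H : set E) b /\ forall s, s \in S -> (H : set E) s.
  by split=> [|s Ss]; apply: sub_gen; rewrite /= !inE ?eqxx ?Ss ?orbT.
suff [n n0 Sn] : exists2 n, (0 < n)%N & forall s, s \in S ->
    lower_central H c [~ b ^+ n, s].
  exists n => // s /Sn; rewrite Lc /= => /eqP/commgP //.
suff [n n0 Sn] : exists2 n, (0 < n)%N & forall s, s \in S ->
    lower_central H c [~ b ^+ n, s] /\ torsion [~ b ^+ n, s].
  by exists n => // s /Sn[].
elim: c {Lc} => [|c [n n0 Sn]].
  exists 1%N => // s Ss; rewrite expg1; split; last exact: Stor.
  exact: (subgrpR (gen_subgrp _) Hb (HS _ Ss)).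
have [|m m0 Sm] := @common_exponent S (fun s => [~ b ^+ n, s]).
  by move=> s /Sn[].
exists (n * m)%N => [|s Ss]; first by rewrite muln_gt0 n0.
have [Ls ts] := Sn s Ss.
(* Working modulo the torsion part of the next term keeps the new commutators torsion, as the
   induction requires. *)
have sN : subgrp (lower_central H c.+1 `&` torsion).
  by apply: subgrpI; [apply: lower_central_subgrp | apply: torsion_subgrp].
have nN y : (H : set E) y -> normalized_by (lower_central H c.+1 `&` torsion) y.
  move=> Hy u [Lu tu].
  by split; [apply: lower_central_normalized | apply: torsionJ].
have Hbn : (H : set E) (b ^+ n) by exact: (subgrpX (gen_subgrp _) n Hb).
have := @expg_comm_mod _ _ sN (b ^+ n) s m (nN _ Hbn) (nN _ (lower_central_sub Ls)).
rewrite Sm // invg1 mul1g -expgnA; apply.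
by split; [apply: lower_central_comm | apply: torsionR].
Qed.

End LocallyNilpotent.

(** * Finiteness *)

Section AbelianModulo.
Context {E : groupType} (N : set E) (sN : subgrp N) (e : nat) (e_gt0 : (0 < e)%N).
Implicit Types (s t : seq E).

Fixpoint mod_span s : set E :=
  if s is x :: s' then
    [set z | exists i : nat, exists2 y, mod_span s' y & z = x ^+ i * y]
  else N.

Fixpoint mod_span_reps s : seq E :=
  if s is x :: s' then
    [seq x ^+ i * y | i <- iota 0 e, y <- mod_span_reps s']
  else [:: 1].

(** The members of [s] commute modulo [N] and have [e]-th powers in [N], so ordered products of
    their powers already form a subgroup modulo [N], and exponents below [e] represent all
    cosets. *)
Lemma mod_span_spec s :
    (forall x, x \in s -> normalized_by N x /\ N (x ^+ e)) ->
    (forall x y, x \in s -> y \in s -> N [~ x, y]) ->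
  [/\ subgrp (mod_span s), N `<=` mod_span s,
      forall x, x \in s -> mod_span s x,
      forall x, normalized_by N x -> (forall y, y \in s -> N [~ y, x]) ->
        normalized_by (mod_span s) x &
      forall z, mod_span s z -> exists2 y, y \in mod_span_reps s & N (y^-1 * z)].
Proof.
elim: s => [|x s IHs] Ns Cs /=.
  split=> // z Nz; exists 1; rewrite ?inE //.
  by rewrite invg1 mul1g.
have {IHs}[||sL NL sub nrm reps] := IHs.
- by move=> y sy; apply: Ns; rewrite inE sy orbT.
- by move=> y z sy sz; apply: Cs; rewrite inE ?sy ?sz orbT.
have [nx Nxe] := Ns x (mem_head _ _).
have nLx i : normalized_by (mod_span s) (x ^+ i).
  have nL1 : normalized_by (mod_span s) x.
    by apply: nrm => // y sy; apply: Cs; rewrite inE ?eqxx ?sy ?orbT.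
  elim: i => [|i IHi] u Lu; first by rewrite conjg1.
  by rewrite expgSr conjgM; apply: nL1; apply: IHi.
have [L1 LM LV] := sL.
have sM : subgrp (mod_span (x :: s)).
  split=> [|_ _ [i [u Lu ->]] [j [v Lv ->]]|_ [i [u Lu ->]]] /=.
  - by exists 0%N, 1 => //; rewrite mulg1.
  - exists (i + j)%N, (u ^ (x ^+ j) * v); first by apply: LM => //; apply: nLx.
    by rewrite expgnDr /conjg !gnorm.
  (* Natural exponents suffice for inverses: [x ^- i] is [x ^+ (i * e.-1)] times the inverse of
     [x ^+ (i * e)], which lies in [N]. *)
  - exists (i * e.-1)%N, ((u^-1) ^ (x ^+ (i * e.-1)) * (x ^+ (i * e))^-1).
      apply: LM; first by apply/nLx/LV.
      by apply: LV; rewrite mulnC expgnA; apply: (subgrpX sL); apply: NL.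
    rewrite -(prednK e_gt0) mulnS expgnDr /conjg invgM !mulgA mulgV mul1g.
    rewrite invgM -!mulgA; congr (_ * _).
    by rewrite mulgA mulgV mul1g.
split=> //.
- by move=> u Nu; exists 0%N, u; [apply: NL | rewrite mul1g].
- move=> y; rewrite inE => /orP[/eqP ->|/sub Ly].
    by exists 1%N, 1 => //; rewrite mulg1.
  by exists 0%N, y => //; rewrite mul1g.
- move=> y ny Cy _ [i [u Lu ->]]; rewrite conjMg; case: (sM) => _ MM _; apply: MM.
    rewrite conjXg; apply: (subgrpX sM); exists 1%N, [~ x, y].
      by apply/NL/Cy; rewrite mem_head.
    by rewrite expg1 -conjg_mulR.
  exists 0%N, (u ^ y); last by rewrite mul1g.
  by apply: nrm => // z sz; apply: Cy; rewrite inE sz orbT.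
- move=> _ [i [u Lu ->]].
  have [y ry Ny] : exists2 y, y \in mod_span_reps s &
      N (y^-1 * (x ^+ (i %/ e * e) * u)).
    apply: reps; apply: LM => //.
    by rewrite mulnC expgnA; apply: (subgrpX sL); apply: NL.
  exists (x ^+ (i %% e) * y).
    by apply: allpairs_f => //; rewrite mem_iota add0n ltn_mod e_gt0.
  rewrite invgM {2}(divn_eq i e) addnC expgnDr -!mulgA.
  by rewrite mulKg.
Qed.

Lemma size_mod_span_reps s : size (mod_span_reps s) = (e ^ size s)%N.
Proof.
elim: s => //= x s IHs.
by rewrite size_allpairs IHs size_iota expnS.
Qed.

End AbelianModulo.

(** Each factor [L n / L n.+1] is abelian and generated by the finitely many left-normed commutators
    [C n] in [S], which are torsion; so it is finite, and representatives of the factors multiply up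
    to those of the group. *)
Lemma finite_gen_torsion (E : groupType) (S : seq E) : locally_nilpotent E ->
    (forall s, s \in S -> torsion s) ->
  finite_set (generated [set` S]).
Proof.
move=> Enil Stor; pose H := gen_subgroup [set` S].
pose L := lower_central H; have sL := lower_central_subgrp H.
pose C := fix C n := if n is m.+1 then [seq [~ a, s] | a <- C m, s <- S] else S.
have HS s : s \in S -> (H : set E) s by exact: sub_gen.
have CL n a : a \in C n -> L n a.
  elim: n a => [|n IHn] a; first exact: HS.
  case/allpairsP => -[b s] /= [Cb Ss ->].
  by apply: lower_central_comm; [exact: IHn | exact: HS].
pose G n := generated ([set` C n] `|` L n.+1).
have sG n : subgrp (G n) by exact: gen_subgrp.
have GC n a : a \in C n -> G n a by move=> Ca; apply: sub_gen; left.
have GL n a : L n.+1 a -> G n a by move=> La; apply: sub_gen; right.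
have G_L n : G n `<=` L n.
  by apply: gen_min => // a [/CL|/lower_centralS].
have nG n y : (H : set E) y -> normalized_by (G n) y.
  move=> Hy u Gu; rewrite conjg_mulR; case: (sG n) => _ GM _; apply: GM => //.
  by apply: GL; apply: lower_central_comm => //; apply: G_L.
(* Since [H] normalizes [G n.+1], membership of [[~ x, y]] in it passes from generators to products
   and inverses, first in [x] and then in [y]. *)
have LG n : L n `<=` G n.
  elim: n => [|n IHn]; first by apply: gen_min => // s Ss; apply: GC.
  have [_ GM GV] := sG n.+1.
  have sY (y : E) : (H : set E) y ->
      subgrp [set x | L n x /\ G n.+1 [~ x, y]].
    move=> Hy; have [L1 LM LV] := sL n; split=> [|u v [Lu Gu] [Lv Gv]|u [Lu Gu]].
    - by split=> //; rewrite comm1g; case: (sG n.+1).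
    - split; first exact: LM.
      rewrite commgMl; apply: GM => //; apply: nG => //.
      exact: (lower_central_sub Lv).
    - split; first exact: LV.
      have -> : [~ u^-1, y] = ([~ u, y]^-1) ^ u^-1.
        by rewrite /commg /conjg !gnorm.
      apply: nG; last exact: GV.
      by case: (subgroupP H) => _ _; apply; apply: (lower_central_sub Lu).
  have step s x : s \in S -> L n x -> G n.+1 [~ x, s].
    move=> Ss /IHn Gx; suff [] : L n x /\ G n.+1 [~ x, s] by [].
    apply: (gen_min (sY s (HS s Ss)) _ Gx) => a [Ca|La].
      split; first exact: CL.
      by apply: GC; apply: allpairs_f.
    split; first exact: lower_centralS.
    by apply: GL; apply: lower_central_comm => //; apply: HS.
  apply: gen_min => // _ [x [y [Lx Hy ->]]].
  suff /(_ y Hy)[_ /(_ x Lx)] : (H : set E) `<=`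
      [set y | (H : set E) y /\ forall x, L n x -> G n.+1 [~ x, y]] by [].
  apply: gen_min => [|s Ss]; last by split=> [|z Lz]; [apply: HS | apply: step].
  have [H1 HM HV] := subgroupP H.
  split=> [|u v [Hu Gu] [Hv Gv]|u [Hu Gu]].
  - by split=> // z _; rewrite commg1; case: (sG n.+1).
  - split=> [|z Lz]; first exact: HM.
    by rewrite commgMr; apply: GM; [exact: Gv | exact: nG Hv _ (Gu _ Lz)].
  - split=> [|z Lz]; first exact: HV.
    have -> : [~ z, u^-1] = ([~ z, u]^-1) ^ u^-1.
      by rewrite /commg /conjg !gnorm.
    exact: nG (HV _ Hu) _ (GV _ (Gu _ Lz)).
have reps n : exists t : seq E, forall z, L n z ->
    exists2 y, y \in t & L n.+1 (y^-1 * z).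
  have [|e e0 Ce] := @common_exponent _ (C n) id.
    move=> a /CL/lower_central_sub Ha.
    exact: (gen_torsion Enil Stor Ha).
  have [||sM NM subM _ repsM] := mod_span_spec (sL n.+1) e0 (s := C n).
  - move=> a Ca; rewrite Ce //; split; last by case: (sL n.+1).
    by apply: lower_central_normalized; apply: lower_central_sub (CL _ _ Ca).
  - move=> a b Ca Cb; apply: lower_central_comm; first exact: CL.
    exact: lower_central_sub (CL _ _ Cb).
  exists (mod_span_reps e (C n)) => z /LG Gz; apply: repsM.
  by apply: (gen_min sM _ Gz) => a [/subM|/NM].
have [c Lc] := gen_seq_nilpotent Enil S.
suff [t tP] : exists t : seq E, forall z, L 0%N z ->
    exists2 y, y \in t & L c (y^-1 * z).
  apply: (@sub_finite_set _ _ [set` t]); last exact: finite_seq.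
  move=> z /tP[y ty]; rewrite /L Lc /= => yz.
  by rewrite (_ : z = y) //; move/mulg1_eq: yz; rewrite invgK.
elim: c {Lc} => [|c [t tP]].
  exists [:: 1] => z Lz; exists 1; rewrite ?inE //.
  by rewrite invg1 mul1g.
have [r rP] := reps c.
exists [seq y * x | y <- t, x <- r] => z /tP[y ty /rP[x rx Lx]].
exists (y * x); first exact: allpairs_f.
by rewrite invgM -mulgA.
Qed.

(* The finitely many [K]-conjugates of [a] generate a group whose image modulo
   [U] has at most [e ^ size K] elements, whereas a point of depth [n] in the
   tower [layer] produces [n] different ones. *)
Section BoundedLayers.
Context {E : groupType} (Enil : locally_nilpotent E).
Context (K : seq E) (sK : subgrp [set` K]) (D U : set E).
Context (sD : subgrp D) (sU : subgrp U) (UD : U `<=` D).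
Context (cD : forall x y, D x -> D y -> commute x y).
Context (nDK : forall k, k \in K -> normalized_by D k).
Context (nUK : forall k, k \in K -> normalized_by U k).
Context (e : nat) (e_gt0 : (0 < e)%N) (De : forall x, D x -> U (x ^+ e)).

(** The upper central series of the action of [K] on [D] relative to [U]: modulo [layer n],
    [layer n.+1] consists of the points of [D] fixed by [K]. *)
Fixpoint layer n : set E :=
  if n is m.+1 then [set a | D a /\ forall k, k \in K -> layer m [~ a, k]] else U.

Lemma layer_sub n : layer n `<=` D.
Proof. by case: n => [|n] // a []. Qed.

Lemma layer_subgrp n : subgrp (layer n).
Proof.
have [D1 DM DV] := sD.
have DK a k : D a -> k \in K -> D [~ a, k].
  by move=> Da Kk; apply: DM; [apply: DV | apply: nDK].
elim: n => [|n [L1 LM LV]] //; split=> [|a b [Da La] [Db Lb]|a [Da La]].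
- by split=> // k Kk; rewrite comm1g.
- split=> [|k Kk]; first exact: DM.
  rewrite commgMl (_ : _ ^ b = [~ a, k]); first by apply: LM; [exact: La | exact: Lb].
  by rewrite /conjg (cD (DK _ _ Da Kk) Db) mulKg.
- split=> [|k Kk]; first exact: DV.
  rewrite (_ : [~ a^-1, k] = [~ a, k]^-1); first exact: LV (La _ Kk).
  have := cD (DK _ _ Da Kk) (DV _ Da); rewrite /commute => caV.
  rewrite (_ : [~ a^-1, k] = a * [~ a, k]^-1 * a^-1).
    by rewrite -mulgA (commute_sym (commuteV (commute_sym caV))) mulgA mulgV mul1g.
  by rewrite /commg /conjg !gnorm.
Qed.

Lemma layer_base n : U `<=` layer n.
Proof.
elim: n => [|n IHn] u Uu //; split=> [|k Kk]; first exact: UD.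
apply: IHn; case: sU => _ UM UV.
by apply: UM; [apply: UV | apply: nUK].
Qed.

Lemma layerS n : layer n `<=` layer n.+1.
Proof.
elim: n => [|n IHn]; first exact: layer_base.
by move=> a [Da La]; split=> // k Kk; apply: IHn; apply: La.
Qed.

Lemma layer_le m n : (m <= n)%N -> layer m `<=` layer n.
Proof.
move=> /subnKC <-; elim: (n - m)%N => [|k IHk] x; first by rewrite addn0.
by rewrite addnS => /IHk/layerS.
Qed.

(** Otherwise some point outside all layers has each commutator with [K] in a layer; [K] being
    finite, one layer contains them all, and the point lies in the next. *)
Lemma layer_exhaust a : D a -> exists n, layer n a.
Proof.
move=> Da; apply: contrapT => noa.
have [|y s Dy Ks|||y [Dy Ny sy]] :=
    @last_outside _ Enil K D [set x | exists n, layer n x] a => //.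
- by exists 0%N; case: sU.
- have [_ DM DV] := sD.
  by apply: DM; [apply: DV | apply: nDK].
suff max (t : seq E) : {subset t <= K} ->
    exists n, forall s, s \in t -> layer n [~ y, s].
  by have [n nP] := max K (fun x Kx => Kx); apply: Ny; exists n.+1.
elim: t => [|k s IHs] sub; first by exists 0%N.
have [|n nP] := IHs; first by move=> z sz; apply: sub; rewrite inE sz orbT.
have [m mP] := sy k (sub _ (mem_head _ _)).
exists (maxn m n) => z; rewrite inE => /orP[/eqP ->|/nP].
  exact: layer_le (leq_maxl _ _) _ mP.
exact: layer_le (leq_maxr _ _) _.
Qed.

Lemma layer_chain n a (W : set E) : (forall w k, W w -> k \in K -> W [~ w, k]) ->
    W a -> layer n.+1 a -> ~ layer n a ->
  exists2 f : nat -> E, (forall i, (i <= n)%N -> W (f i)) &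
    forall i, (i <= n)%N -> layer i.+1 (f i) /\ ~ layer i (f i).
Proof.
move=> WR; elim: n a => [|n IHn] a Wa La Na.
  by exists (fun=> a) => // i; rewrite leqn0 => /eqP ->.
have [Da LaK] := La.
have [k Kk Nk] : exists2 k, k \in K & ~ layer n [~ a, k].
  apply: contrapT => nok; apply: Na; split=> // k Kk.
  by apply: contrapT => Nk; apply: nok; exists k.
have [f Wf Lf] := IHn _ (WR _ _ Wa Kk) (LaK _ Kk) Nk.
exists (fun i => if (i <= n)%N then f i else a) => i le_in.
  by case: leqP => // le_in'; apply: Wf.
case: leqP => [/Lf //|lt_ni].
by rewrite (_ : i = n.+1) //; apply/eqP; rewrite eqn_leq le_in.
Qed.

Lemma layer_bounded : exists n, D `<=` layer n.
Proof.
exists (e ^ size K)%N => a Da; apply: contrapT => Na.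
have [n [lt_n La Nn]] : exists n,
    [/\ (e ^ size K <= n)%N, layer n.+1 a & ~ layer n a].
  have [m Lm] := layer_exhaust Da.
  have ltm : (e ^ size K <= m)%N.
    by rewrite leqNgt; apply/negP => /ltnW/layer_le/(_ _ Lm).
  rewrite -(subnKC ltm) in Lm; move: Lm.
  elim: (m - _)%N => [|k IHk] Lk; first by rewrite addn0 in Lk.
  have [/IHk //|Nk] := pselect (layer (e ^ size K + k) a).
  by exists (e ^ size K + k)%N; split; rewrite ?leq_addr -?addnS.
pose C := [seq a ^ k | k <- K].
have DC x : x \in C -> D x by case/mapP => k Kk ->; apply: nDK.
have nUD x : D x -> normalized_by U x.
  by move=> Dx u Uu; rewrite /conjg -(cD Dx (UD Uu)) mulKg.
have [||sM UM subM _ repsM] := mod_span_spec sU e_gt0 (s := C).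
- by move=> x /DC Dx; split; [apply: nUD | apply: De].
- move=> x y /DC Dx /DC Dy; rewrite (_ : [~ x, y] = 1); first by case: sU.
  by apply/eqP/commgP/cD.
pose W := generated ([set` C] `|` U).
have sW : subgrp W by exact: gen_subgrp.
have [W1 WM WV] := sW.
have WK w k : W w -> k \in K -> W (w ^ k).
  move=> Ww Kk; suff /(_ _ Ww) : W `<=` [set w | W (w ^ k)] by [].
  apply: gen_min => [|x [/mapP[h Kh ->]|Ux]].
  - split=> [|x y Wx Wy|x Wx] /=; first by rewrite conj1g.
      by rewrite conjMg; apply: WM.
    by rewrite conjVg; apply: WV.
  - apply: sub_gen; left; apply/mapP; exists (h * k); last by rewrite conjgM.
    by case: sK => _ KM _; apply: KM.
  - by apply: sub_gen; right; apply: nUK.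
have [||f Wf Lf] := @layer_chain n a W _ _ La Nn.
- by move=> w k Ww Kk; apply: WM; [apply: WV | apply: WK].
- apply: sub_gen; left; apply/mapP; exists 1; last by rewrite conjg1.
  by case: sK.
have rep i : exists y, (i <= n)%N ->
    y \in mod_span_reps e C /\ U (y^-1 * f i).
  have [le_in|_] := leqP i n; last by exists 1.
  have [|y ry Uy] := repsM (f i); last by exists y.
  by apply: (gen_min sM _ (Wf i le_in)) => x [/subM|/UM].
have [g gP] := choice rep.
(* Pigeonhole: the [n.+1] points of the chain lie in distinct cosets of [U], but there are only
   [e ^ size K <= n] representatives. *)
suff : (n.+1 <= size (mod_span_reps e C))%N.
  by rewrite size_mod_span_reps size_map leqNgt ltnS lt_n.
rewrite -(size_iota 0 n.+1) -(size_map g); apply: uniq_leq_size; last first.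
  by move=> _ /mapP[i + ->]; rewrite mem_iota ltnS => /= /gP[].
rewrite map_inj_in_uniq ?iota_uniq // => i j.
rewrite !mem_iota !ltnS /= => le_in le_jn gE; apply: contrapT => /eqP.
(* Equal representatives would put [f j'] in the coset [f i' U], hence in [layer j'], which contains
   both [f i'] and [U]. *)
have sep i' j' : (j' <= n)%N -> (i' < j')%N -> g i' = g j' -> False.
  move=> le_jn' lt_ij gE'; have le_in' := leq_trans (ltnW lt_ij) le_jn'.
  have [Li Ni] := Lf i' le_in'; have [Lj Nj] := Lf j' le_jn'.
  apply: Nj; have [_ Ui] := gP i' le_in'; have [_ Uj] := gP j' le_jn'.
  rewrite -gE' in Uj.
  have [_ LM LV] := layer_subgrp j'.
  have {}Li : layer j' (f i') by exact: layer_le lt_ij _ Li.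
  rewrite -(mulVKg (f i') (f j')); apply: LM => //; apply: layer_base.
  have -> : (f i')^-1 * f j' = ((g i')^-1 * f i')^-1 * ((g i')^-1 * f j').
    by rewrite !gnorm.
  by case: sU => _ UM' UV; apply: UM' => //; apply: UV.
by rewrite neq_ltn => /orP[] lt_ij; [exact: sep lt_ij gE | exact: sep lt_ij (esym gE)].
Qed.

End BoundedLayers.

(** * Maximal subgroups, prime steps and primary elements *)

Section MoreSubgroups.
Context {E : groupType}.
Implicit Types (A C X : set E) (x y : E).

Lemma maximal_avoiding C X : subgrp C -> (forall x, C x -> ~ X x) ->
  exists M, [/\ subgrp M, C `<=` M, forall x, M x -> ~ X x &
    forall B, subgrp B -> M `<=` B -> (forall x, B x -> ~ X x) -> B `<=` M].
Proof.
move=> sC CX.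
pose P := [set A | A = set0 \/ [/\ subgrp A, C `<=` A & forall x, A x -> ~ X x]].
have [|M [PM maxM]] := @Zorn_bigcup E P.
  move=> F FP totF; have [[A FA A0]|noA] := pselect (exists2 A, F A & A <> set0).
    have [//|[[A1 _ _] CA _]] := FP A FA.
    have ex B y : F B -> B y -> [/\ subgrp B, C `<=` B & forall x, B x -> ~ X x].
      by move=> FB By; have [B0|//] := FP B FB; rewrite B0 in By.
    right; split=> [|x Cx|x [B FB Bx]]; last 2 first.
    - by exists A => //; apply: CA.
    - by have [_ _] := ex B x FB Bx; apply.
    split=> [|x y [B FB Bx] [B' FB' By]|x [B FB Bx]]; first by exists A.
    - have [BB'|B'B] := totF _ _ FB FB'.
        exists B' => //; have [[_ BM _] _ _] := ex B' y FB' By.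
        by apply: BM => //; apply: BB'.
      exists B => //; have [[_ BM _] _ _] := ex B x FB Bx.
      by apply: BM => //; apply: B'B.
    - by exists B => //; have [[_ _ BV] _ _] := ex B x FB Bx; apply: BV.
  left; rewrite -subset0 => x [A FA Ax]; apply: noA; exists A => // A0.
  by rewrite A0 in Ax.
have C1 : C 1 by case: sC.
case: PM => [M0|[sM CM MX]].
  have /maxM[] : M `<` C by rewrite M0; split=> // /(_ _ C1).
  by right; split.
exists M; split=> // B sB MB BX; apply: contrapT => BM.
apply: (maxM B); first by split.
by right; split=> //; apply: subset_trans MB.
Qed.

Lemma prime_step A x n : (0 < n)%N -> A (x ^+ n) -> ~ A x ->
  exists p i, [/\ prime p, (p %| n)%N, ~ A (x ^+ i) & A (x ^+ (i * p))].
Proof.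
elim/ltn_ind: n => n IHn n0 An Nx.
have n1 : (1 < n)%N by rewrite ltn_neqAle n0 andbT; apply/eqP => n1; rewrite -n1 in An.
have pn := pdiv_dvd n; have pp := pdiv_prime n1.
have [Ai|Ni] := pselect (A (x ^+ (n %/ pdiv n))).
  have [||p [i [p_pr p_n Ni Aip]]] := IHn (n %/ pdiv n)%N _ _ Ai Nx.
  - by rewrite ltn_Pdiv ?prime_gt1.
  - by rewrite divn_gt0 ?prime_gt0 // dvdn_leq.
  by exists p, i; split=> //; apply: dvdn_trans p_n (dvdn_div pn).
by exists (pdiv n), (n %/ pdiv n)%N; split=> //; rewrite divnK.
Qed.

Lemma expg_coprime a b x : (0 < a)%N -> coprime a b -> x ^+ a = 1 -> x ^+ b = 1 ->
  x = 1.
Proof.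
move=> a0 /eqP cab xa xb; have [u v eq_uv _] := egcdnP b a0.
rewrite cab in eq_uv; have := congr1 (fun n => x ^+ n) eq_uv.
rewrite /= expgnDr expg1 [(u * a)%N]mulnC [(v * b)%N]mulnC !expgnA xa xb.
by rewrite !expg1n mul1g => <-.
Qed.

Lemma commXg_cent x y n : commute [~ x, y] x -> [~ x ^+ n, y] = [~ x, y] ^+ n.
Proof.
move=> c; elim: n => [|n IHn]; first by rewrite comm1g.
rewrite !expgSr commgMl IHn /conjg -(commuteX n (commute_sym c)).
by rewrite mulKg.
Qed.

Lemma commgX_cent x y n : commute [~ x, y] y -> [~ x, y ^+ n] = [~ x, y] ^+ n.
Proof.
move=> c; elim: n => [|n IHn]; first by rewrite commg1.
rewrite expgSr expgS commgMr IHn /conjg -(commuteX n (commute_sym c)).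
by rewrite mulKg.
Qed.

Lemma primary_mul p A x y : locally_nilpotent E -> subgrp A ->
    (forall a, A a -> commute a x /\ commute a y) ->
    (exists i, A (x ^+ (p ^ i))) -> (exists i, A (y ^+ (p ^ i))) ->
  exists i, A ((x * y) ^+ (p ^ i)).
Proof.
move=> Enil sA cA [i Ax] [j Ay].
pose P n := exists k, n = (p ^ k)%N.
have P1 : P 1%N by exists 0%N.
have PM a b : P a -> P b -> P (a * b)%N.
  by move=> [k ->] [l ->]; exists (k + l)%N; rewrite expnD.
have [_ gM _] := gen_subgrp [set` [:: x; y]].
have gxy : generated [set` [:: x; y]] (x * y).
  by apply: gM; apply: sub_gen; rewrite /= !inE eqxx ?orbT.
have [s a|s|n [k ->] Ak] := gen_expg Enil P1 PM sA _ _ gxy; last by exists k.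
- by rewrite !inE => /orP[] /eqP -> /cA[].
- rewrite !inE => /orP[] /eqP ->; [exists (p ^ i)%N | exists (p ^ j)%N] => //.
    by exists i.
  by exists j.
Qed.

Lemma bijective_of_inj_surj (f : E -> E) : injective f -> (forall y, exists x, f x = y) ->
  bijective f.
Proof.
move=> f_inj /choice[g gK]; exists g => // x; apply: f_inj; exact: gK.
Qed.

End MoreSubgroups.

Lemma count_lt (T : eqType) (a b : pred T) (s : seq T) x :
  (forall y, a y -> b y) -> x \in s -> b x -> ~~ a x -> (count a s < count b s)%N.
Proof.
move=> ab + bx /negbTE ax; elim: s => //= y s IHs.
rewrite inE => /orP[/eqP <-|/IHs lt_s]; first by rewrite ax bx ltnS sub_count.
rewrite -addnS leq_add //.
by have := ab y; case: (a y) => // ->.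
Qed.

Lemma gen_normal (E : groupType) (X : set E) :
  (forall x y, X x -> X (x ^ y)) -> normal_in (generated X).
Proof.
move=> XJ y u Xu; have [g1 gM gV] := gen_subgrp X.
suff /(_ u Xu) : generated X `<=` [set u | generated X (u ^ y)] by [].
apply: gen_min => [|x Xx]; last by apply: sub_gen; apply: XJ.
split=> [|a b Ya Yb|a Ya] /=; first by rewrite conj1g.
  by rewrite conjMg; apply: gM.
by rewrite conjVg; apply: gV.
Qed.

Lemma mul_subgrp (E : groupType) (A N : set E) : subgrp A -> subgrp N -> normal_in N ->
  subgrp [set x | exists2 a, A a & exists2 n, N n & x = a * n].
Proof.
move=> [A1 AM AV] [N1 NM NV] nN; split.
- by exists 1 => //; exists 1 => //; rewrite mulg1.
- move=> _ _ [a Aa [n Nn ->]] [b Ab [k Nk ->]].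
  exists (a * b); first exact: AM.
  exists (n ^ b * k); first by apply: NM => //; apply: nN.
  by rewrite /conjg !gnorm.
- move=> _ [a Aa [n Nn ->]]; exists a^-1; first exact: AV.
  exists (n^-1 ^ a^-1); first exact/nN/NV.
  by rewrite /conjg !gnorm.
Qed.

(** * Divisible abelian subgroups *)

Lemma expg_coprime_root (E : groupType) (x : E) a b : (0 < b)%N -> coprime a b ->
  x ^+ a = 1 -> exists l, (x ^+ l) ^+ b = x.
Proof.
move=> b0; rewrite coprime_sym => /eqP cba xa.
have [u v eq_uv _] := egcdnP a b0; rewrite cba in eq_uv.
by exists u; rewrite -expgnA eq_uv expgnDr mulnC expgnA xa expg1n mul1g.
Qed.

Lemma perm_prodg (E : groupType) (T : eqType) (F : T -> E) (s t : seq T) :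
    (forall i j, commute (F i) (F j)) -> perm_eq s t ->
  \prod_(i <- s) F i = \prod_(i <- t) F i.
Proof.
move=> cF; pose P r := \prod_(i <- s) F i = \prod_(i <- r) F i.
move=> st; apply: (@catCA_perm_ind _ P _ _ _ st) => // s1 s2 s3.
rewrite /P !big_cat /= !mulgA => ->; congr (_ * _).
by apply: commute_prod => j _; apply/commute_sym/commute_prod.
Qed.

Section DivisibleComplement.
Context {E : groupType} (D P : set E) (sD : subgrp D) (sP : subgrp P) (PD : P `<=` D).
Context (cD : forall x y, D x -> D y -> commute x y).
Context (Pdiv : forall q x, prime q -> P x -> exists2 y, P y & x = y ^+ q).

(** Zorn gives [M] maximal in [D] with trivial intersection with [P]. If [P M] missed a point, some
    [x] outside it would have [x ^+ q] inside for a prime [q]; divisibility of [P] corrects [x] to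
    [y] with [y ^+ q] in [M], and maximality of [M] then puts [y] in [P M]. *)
Lemma divisible_complement : exists M, [/\ subgrp M, M `<=` D,
  forall x, M x -> P x -> x = 1 &
  forall x, D x -> exists2 a, P a & exists2 n, M n & x = a * n].
Proof.
have [D1 DM DV] := sD; have [P1 PM PV] := sP.
pose bad := [set x | ~ D x \/ P x /\ x <> 1].
have [|M [sM _ Mbad maxM]] := @maximal_avoiding _ [set 1] bad (subgrp1).
  by move=> _ -> [|[]] //; apply.
have [M1 MM MV] := sM.
have MD : M `<=` D by move=> x Mx; apply: contrapT => Dx; apply: (Mbad x) => //; left.
have MP x : M x -> P x -> x = 1.
  by move=> Mx Px; apply: contrapT => x1; apply: (Mbad x) => //; right.
exists M; split=> // x0 Dx0.
pose PMset := [set x | exists2 a, P a & exists2 n, M n & x = a * n].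
have sPM : subgrp PMset.
  split=> [|_ _ [a Pa [n Mn ->]] [b Pb [k Mk ->]]|_ [a Pa [n Mn ->]]].
  - by exists 1 => //; exists 1 => //; rewrite mulg1.
  - exists (a * b); first exact: PM.
    exists (n * k); first exact: MM.
    rewrite -!mulgA; congr (_ * _); rewrite !mulgA; congr (_ * _).
    by apply: cD; [apply: MD | apply: PD].
  - exists a^-1; first exact: PV.
    exists n^-1; first exact: MV.
    by rewrite invgM; apply: cD; [apply/DV/MD | apply/DV/PD].
have [_ PMM PMV] := sPM.
have P_PM a : P a -> PMset a by move=> Pa; exists a => //; exists 1; rewrite ?mulg1.
have M_PM n : M n -> PMset n by move=> Mn; exists 1 => //; exists n; rewrite ?mul1g.
have hit x : D x -> ~ M x ->
    exists a n, [/\ (0 < a)%N, M n, P (x ^+ a * n) & x ^+ a * n <> 1].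
  move=> Dx Nx.
  (* The subgroup generated by [x] and [M], with integer exponents coded as differences of natural
     ones. *)
  pose B := [set z | exists i j n, M n /\ z = x ^+ i * x ^- j * n].
  have DXx i : D (x ^+ i) by exact: (subgrpX sD).
  have sB : subgrp B.
    split=> [|_ _ [i [j [n [Mn ->]]]] [i' [j' [n' [Mn' ->]]]]|_ [i [j [n [Mn ->]]]]].
    - by exists 0%N, 0%N, 1; split=> //; rewrite !expg0 !gnorm.
    - exists (i + i')%N, (j + j')%N, (n * n'); split; first exact: MM.
      have c1 : commute n (x ^+ i' * x ^- j').
        by apply: cD; [apply: MD | apply: (DM) => //; apply: (DV)].
      have c2 : commute (x ^- j) (x ^+ i') by apply: cD => //; apply: (DV).
      have c3 : commute (x ^- j') (x ^- j) by apply: cD; apply: (DV).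
      have -> : x ^+ i * x ^- j * n * (x ^+ i' * x ^- j' * n') =
          x ^+ i * (x ^- j * (n * (x ^+ i' * x ^- j')) * n') by rewrite !mulgA.
      rewrite !expgnDr invgM c3 c1 !mulgA; congr (_ * _ * _ * _).
      by rewrite -!mulgA c2.
    - exists j, i, n^-1; split; first exact: MV.
      rewrite !invgM invgK; apply: cD; first exact/DV/MD.
      by apply: (DM) => //; apply: (DV).
  have [z [i [j [n [Mn zE]]]] [//|[Pz z1]]] : exists2 z, B z & bad z.
    apply: contrapT => noz; apply: Nx; apply: (maxM B) => //.
    - by move=> z Mz; exists 0%N, 0%N, z; split=> //; rewrite !expg0 !gnorm.
    - by move=> z Bz badz; apply: noz; exists z.
    - by exists 1%N, 0%N, 1; split=> //; rewrite expg0 expg1 !gnorm.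
  - by case; rewrite zE; apply: (DM); [apply: (DM) => //; apply: (DV) | apply: MD].
  have [le_ji|lt_ij] := leqP j i.
    exists (i - j)%N, n; rewrite expgnFr // -zE; split=> //.
    rewrite lt0n; apply/eqP => ij0; apply: z1; apply: MP => //.
    by rewrite zE -expgnFr // ij0 expg0 mul1g.
  exists (j - i)%N, n^-1; have -> : x ^+ (j - i) * n^-1 = z^-1.
    rewrite zE expgnFr ?(ltnW lt_ij) // !invgM invgK; apply: cD.
      by apply: (DM) => //; apply: (DV).
    exact/DV/MD.
  rewrite subn_gt0; split=> //; [exact: MV|exact: PV|].
  by move=> zV; apply: z1; rewrite -[z]invgK zV invg1.
apply: contrapT => Nx0.
have hit_PM x : D x -> ~ PMset x -> exists a n,
    [/\ (0 < a)%N, M n, P (x ^+ a * n) & x ^+ a * n <> 1] /\ PMset (x ^+ a).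
  move=> Dx Nx; have [|a [n [a0 Mn Pa an1]]] := hit x Dx; first by move/M_PM.
  exists a, n; split=> //; rewrite -(mulgK n (x ^+ a)).
  by apply: PMM; [apply: P_PM | apply: M_PM; apply: MV].
have [a [_ [[a0 _ _ _] PMa]]] := hit_PM x0 Dx0 Nx0.
have [q [i [q_pr _ Ni [v Pv [n Mn vnE]]]]] := prime_step a0 PMa Nx0.
have [w Pw vE] := Pdiv q_pr Pv.
set x := x0 ^+ i in Ni; have Dx : D x by exact: (subgrpX sD).
pose y := x * w^-1.
have Dy : D y by apply: (DM) => //; apply/DV/PD.
have Ny : ~ PMset y.
  move=> PMy; apply: Ni; rewrite -(mulgVK w x).
  by apply: PMM => //; apply: P_PM.
have yq : y ^+ q = n.
  rewrite /y (expgMn _ (cD Dx (DV _ (PD Pw)))) expVgn -vE -expgnA vnE.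
  by rewrite -(cD (DV _ (PD Pv)) (DM _ _ (PD Pv) (MD _ Mn))) mulKg.
have [b [k [[b0 Mk Pb bk1] PMb]]] := hit_PM y Dy Ny.
(* If [q] divides [b], the nontrivial [y ^+ b * k] lies in both [P] and [M]; otherwise Bezout
   expresses [y] through [y ^+ q] and [y ^+ b], both in [P M]. *)
have [/dvdnP[l bE]|] := boolP (q %| b)%N.
  apply: bk1; apply: MP => //; apply: MM => //.
  by rewrite bE mulnC expgnA yq; apply: (subgrpX sM).
rewrite -prime_coprime // => /eqP cqb.
have [l t lbE _] := egcdnP b (prime_gt0 q_pr); rewrite cqb in lbE.
apply: Ny; rewrite -(mulKg (y ^+ (t * b)) y); apply: PMM.
  by apply: PMV; rewrite mulnC expgnA; apply: (subgrpX sPM).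
rewrite -expgSr -addn1 -lbE mulnC expgnA yq; apply: M_PM; exact: (subgrpX sM).
Qed.

Lemma divisible_retraction : exists f : E -> E,
  [/\ forall x, D x -> P (f x), forall x y, D x -> D y -> f (x * y) = f x * f y &
      forall x, P x -> f x = x].
Proof.
have [M [sM MD MP DPM]] := divisible_complement.
have [D1 DM DV] := sD; have [P1 PM PV] := sP; have [M1 MM MV] := sM.
have [f fP] : exists f : E -> E, forall x, D x -> P (f x) /\ M ((f x)^-1 * x).
  suff ex x : exists a, D x -> P a /\ M (a^-1 * x) by have [f fP] := choice ex; exists f.
  have [Dx|] := pselect (D x); last by exists 1.
  by have [a Pa [n Mn ->]] := DPM x Dx; exists a; rewrite mulKg.
have f_uniq x a : D x -> P a -> M (a^-1 * x) -> f x = a.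
  move=> Dx Pa Ma; have [Pf Mf] := fP x Dx.
  apply/esym/(@mulgI _ a^-1); rewrite mulVg; apply/esym/MP.
    have -> : a^-1 * f x = a^-1 * x * ((f x)^-1 * x)^-1 by rewrite !gnorm.
    by apply: MM => //; apply: MV.
  by apply: PM => //; apply: PV.
exists f; split=> [x Dx|x y Dx Dy|x Px]; first by case: (fP x Dx).
  have [Px Mx] := fP x Dx; have [Py My] := fP y Dy.
  apply: f_uniq; [exact: DM|exact: PM|].
  have -> : (f x * f y)^-1 * (x * y) = (f x)^-1 * x * ((f y)^-1 * y).
    rewrite (cD (PD Px) (PD Py)) invgM -!mulgA; congr (_ * _).
    rewrite !mulgA; congr (_ * _).
    by apply: cD => //; apply/DV/PD.
  exact: MM.
by apply: f_uniq => //; [apply: PD | rewrite mulVg].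
Qed.

(* Averaging the retraction over [K] makes it equivariant, at the price of
   replacing the identity of [P] by a power map. *)
Lemma equivariant_retraction (K : seq E) :
    subgrp [set` K] -> normal_in D -> normal_in P ->
  exists f : E -> E, exists2 s, (0 < s)%N &
  [/\ forall x, D x -> P (f x), forall x y, D x -> D y -> f (x * y) = f x * f y,
      forall x, P x -> f x = x ^+ s &
      forall x k, D x -> k \in K -> f (x ^ k) = f x ^ k].
Proof.
move=> [K1 KM KV] nD nP; have [r [rP rM rid]] := divisible_retraction.
have [D1 DM DV] := sD; have [P1 PM PV] := sP.
pose F d k := r (d ^ k^-1) ^ k.
have PF d k : D d -> P (F d k) by move=> Dd; apply/nP/rP/nD.
have cF d e j k : D d -> D e -> commute (F d j) (F e k).
  by move=> Dd De; apply: cD; apply/PD/PF.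
(* Without repetitions in the list, right translation by [q^-1] permutes the factors, which yields
   equivariance; their number is the exponent on [P]. *)
exists (fun d => \prod_(k <- undup K) F d k); exists (size (undup K)).
  by rewrite -has_predT; apply/hasP; exists 1; rewrite ?mem_undup.
split=> [x Dx|x y Dx Dy|x Px|x q Dx Kq].
- by apply: big_ind => // k _; apply: PF.
- rewrite -prodgM_commute => [|i j _ _]; last exact: cF.
  by apply: eq_bigr => k _; rewrite /F conjMg rM ?conjMg //; apply: (nD).
- rewrite (eq_bigr (fun=> x)) => [|k _].
    by elim: (undup K) => [|k s IHs]; rewrite ?big_nil // big_cons IHs expgS.
  by rewrite /F rid ?conjgKV //; apply: nP.
- rewrite conjg_prod.
  rewrite (eq_bigr (fun k => F x (k * q^-1) ^ q)) => [|k _]; last first.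
    by rewrite /F -!conjgM invgM invgK mulgVK.
  rewrite -(big_map (fun k => k * q^-1) xpredT (fun k => F x k ^ q)).
  apply: perm_prodg => [i j|].
    by rewrite /commute -!conjMg; congr (_ ^ _); apply: cF.
  apply: uniq_perm; rewrite ?undup_uniq // ?map_inj_uniq ?undup_uniq //.
    exact: mulIg.
  move=> k; apply/mapP/idP => [[h + ->]|]; rewrite !mem_undup => Kk.
    by apply: KM => //; apply: KV.
  by exists (k * q); rewrite ?mulgK // mem_undup; apply: KM.
Qed.

End DivisibleComplement.

(** * Groups whose automorphisms over K are trivial *)

Section Rigidity.
Context {E : groupType} (Enil : locally_nilpotent E).
Context (G : set E) (sG : subgrp G) (nG : normal_in G).
Context (K : seq E) (sK : subgrp [set` K]).
Context (EKG : forall x : E, exists2 k, k \in K & exists2 g, G g & x = k * g).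
Context (m : nat) (m_gt0 : (0 < m)%N) (Km : forall k, k \in K -> k ^+ m = 1).
Context (rigid : forall f : E -> E, {morph f : x y / x * y} -> bijective f ->
  (forall x, G (x^-1 * f x)) -> (forall k, k \in K -> f k = k) -> forall x, f x = x).

Definition fixed : set E := [set z | G z /\ forall k, k \in K -> commute z k].
Local Notation Z := fixed.

(** Conjugation by [z] fixes [K] and is trivial modulo the normal subgroup [G], so rigidity makes it
    the identity. *)
Lemma fixed_central z x : Z z -> commute z x.
Proof.
move=> [Gz cz]; have := @rigid (fun x => x ^ z) _ _ _ _ x.
move=> xz; apply/commute_sym/commgP; rewrite -conjg_fix; apply/eqP; apply: xz.
- by move=> a b; rewrite conjMg.
- by exists (fun x => x ^ z^-1); [apply: conjgK | apply: conjgKV].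
- move=> a; rewrite -commgEl commgEr; case: sG => _ GM GV.
  by apply: GM => //; apply/nG/GV.
- by move=> k Kk; rewrite /conjg -(cz k Kk) mulKg.
Qed.

Lemma fixed_subgrp : subgrp Z.
Proof.
have -> : Z = G `&` [set z | forall y, y \in K -> commute y z].
  by apply/seteqP; split=> z [Gz cz]; split=> // k Kk; apply/commute_sym/cz.
by apply: subgrpI => //; apply: subgrp_cent.
Qed.

Lemma fixed_normal : normal_in Z.
Proof. by move=> x z Zz; rewrite /conjg (fixed_central x Zz) mulKg. Qed.

(** Rigidity applies to the map [q r |-> q u(r)] on [E = Q R]: it is well defined because [u] is the
    identity on the intersection of [Q] and [R], and multiplicative because [u] is
    [Q]-equivariant. *)
Lemma rigid_on (Q R : set E) (u : E -> E) : subgrp Q -> subgrp R -> normal_in R ->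
    R `<=` G -> [set` K] `<=` Q ->
    (forall x : E, exists2 q, Q q & exists2 r, R r & x = q * r) ->
    (forall r, R r -> R (u r)) ->
    (forall r s, R r -> R s -> u (r * s) = u r * u s) ->
    (forall r, R r -> u r = 1 -> r = 1) ->
    (forall s, R s -> exists2 r, R r & u r = s) ->
    (forall r q, R r -> Q q -> u (r ^ q) = u r ^ q) ->
    (forall r, Q r -> R r -> u r = r) ->
  forall r, R r -> u r = r.
Proof.
move=> sQ sR nR RG KQ EQR uR uM u_inj u_surj uJ uid.
have [Q1 QM QV] := sQ; have [R1 RM RV] := sR.
have [q qP] := choice (fun x => let: ex_intro2 q Qq h := EQR x in
  ex_intro (fun q => Q q /\ exists2 r, R r & x = q * r) q (conj Qq h)).
pose f x := q x * u ((q x)^-1 * x).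
have qR x : R ((q x)^-1 * x).
  by have [_ [r Rr xE]] := qP x; rewrite {2}xE mulKg.
(* Independence of the chosen factorisation: two left factors of the same element differ by some [t]
   in both [Q] and [R], which [u] fixes. *)
have fE a r : Q a -> R r -> f (a * r) = a * u r.
  move=> Qa Rr; rewrite /f; set x := a * r.
  have [Qq _] := qP x; have Rs := qR x.
  set s := (q x)^-1 * x in Rs *; pose t := a^-1 * q x.
  have tE : t = r * s^-1 by rewrite /t /s /x !gnorm.
  have Qt : Q t by apply: QM => //; apply: QV.
  have Rt : R t by rewrite tE; apply: RM => //; apply: RV.
  have -> : u r = u t * u s by rewrite -uM // tE mulgVK.
  by rewrite (uid t) // /t !mulgA mulgV mul1g.
have fM : {morph f : x y / x * y}.
  move=> x y; have [a Qa [r Rr ->]] := EQR x; have [b Qb [s Rs ->]] := EQR y.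
  have -> : a * r * (b * s) = a * b * (r ^ b * s) by rewrite /conjg !gnorm.
  have Rrb : R (r ^ b) by apply: nR.
  rewrite !fE //; [|exact: QM|exact: RM].
  by rewrite uM // uJ // /conjg !gnorm.
have u1 : u 1 = 1 by apply: (@mulgI _ (u 1)); rewrite -uM // !mulg1.
have uV r : R r -> u r^-1 = (u r)^-1.
  by move=> Rr; apply: (@mulgI _ (u r)); rewrite -uM ?mulgV //; apply: RV.
have f1 : forall x, f x = 1 -> x = 1.
  move=> x; have [a Qa [r Rr ->]] := EQR x; rewrite fE // => au.
  have ra : u r = a^-1 by rewrite (mulg1_eq au).
  have Ra : R a^-1 by rewrite -ra; apply: uR.
  have: u (a * r) = 1.
    rewrite uM //; last by rewrite -[a]invgK; apply: RV.
    by rewrite ra uid ?mulgV // -[a]invgK; apply: RV.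
  by apply: u_inj; apply: RM => //; rewrite -[a]invgK; apply: RV.
have fV x : f x^-1 = (f x)^-1.
  apply: (@mulgI _ (f x)); rewrite -fM !mulgV.
  by rewrite -{1}[1]mulg1 fE // u1 mulg1.
have f_bij : bijective f.
  apply: bijective_of_inj_surj => [x y fxy|y].
    by apply/divg1_eq/f1; rewrite fM fV fxy mulgV.
  have [a Qa [s Rs ->]] := EQR y; have [r Rr <-] := u_surj s Rs.
  by exists (a * r); rewrite fE.
have fG x : G (x^-1 * f x).
  have [a Qa [r Rr ->]] := EQR x; rewrite fE //.
  have -> : (a * r)^-1 * (a * u r) = r^-1 * u r by rewrite !gnorm.
  by apply: RG; apply: RM; [apply: RV | apply: uR].
have fK k : k \in K -> f k = k.
  by move=> /KQ Qk; rewrite -{1}[k]mulg1 fE // u1 mulg1.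
move=> r Rr; have := rigid fM f_bij fG fK r.
by rewrite -{1}[r]mul1g fE // mul1g.
Qed.

Lemma power_fixed g : G g -> exists2 n, (0 < n)%N & Z (g ^+ n).
Proof.
move=> Gg; have [k Kk|n n0 nP] := @power_commutes _ Enil g K.
  by apply: torsionRr => //; exists m => //; apply: Km.
by exists n => //; split; [apply: (subgrpX sG) | apply: nP].
Qed.

Definition relevant (p : nat) : Prop :=
  [/\ prime p, (p %| m)%N & exists c, [/\ Z c, c <> 1 & c ^+ p = 1]].

(** Pass to a last point outside [Z] among those of [q]-power order modulo [Z], then to a power of
    it just outside [Z]. Its nontrivial commutator with some [k] is central and killed by both [q]
    and [m], which forces [q] to divide [m]. *)
Lemma relevant_of_fixed g q : G g -> prime q -> ~ Z g -> Z (g ^+ q) -> relevant q.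
Proof.
move=> Gg q_pr Ng Zgq; have sZ := fixed_subgrp; have [Z1 ZM ZV] := sZ.
have [G1 GM GV] := sG.
pose M := [set x | G x /\ exists i, Z (x ^+ (q ^ i))].
have [|x s [Gx [i Zi]] Ks|||y [[Gy [i Zi]] Ny Zy]] :=
    @last_outside _ Enil K M Z g => //.
- split; first by apply: GM; [apply: GV | apply: nG].
  apply: primary_mul => //.
  + by move=> a Za; split; apply: fixed_central.
  + by exists i; rewrite expVgn; apply: ZV.
  + by exists i; rewrite -conjXg; apply: fixed_normal.
- by split=> //; exists 1%N; rewrite expn1.
have qi0 : (0 < q ^ i)%N by rewrite expn_gt0 prime_gt0.
have [p [j [p_pr p_q Nj Zj]]] := prime_step qi0 Zi Ny.
have pq : p = q.
  by apply/eqP; rewrite -dvdn_prime2 //; move: p_q; rewrite Euclid_dvdX // => /andP[].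
rewrite pq in Zj.
have Zyj k : k \in K -> Z [~ y ^+ j, k].
  move=> Kk; rewrite commXg_cent; first exact: (subgrpX sZ j (Zy k Kk)).
  exact: fixed_central (Zy k Kk).
have [k Kk k_nc] : exists2 k, k \in K & [~ y ^+ j, k] <> 1.
  apply: contrapT => nok; apply: Nj; split=> [|k Kk]; first exact: (subgrpX sG).
  by apply/commgP/eqP; apply: contrapT => k_nc; apply: nok; exists k.
have cq : [~ y ^+ j, k] ^+ q = 1.
  rewrite -commXg_cent; last exact: fixed_central (Zyj k Kk).
  by rewrite -expgnA; apply/eqP/commgP/fixed_central.
have cm : [~ y ^+ j, k] ^+ m = 1.
  rewrite -commgX_cent; last exact: fixed_central (Zyj k Kk).
  by rewrite Km // commg1.
split=> //; last by exists [~ y ^+ j, k]; split=> //; apply: Zyj.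
apply: contrapT => /negP; rewrite -prime_coprime // => cqm.
by apply: k_nc; apply: expg_coprime cqm cq cm; rewrite prime_gt0.
Qed.

(** Take [n] minimal: for each prime [p] dividing it, [g ^+ (n %/ p)] is outside [Z] with its [p]-th
    power inside. *)
Lemma relevant_power g : G g ->
  exists n, [/\ (0 < n)%N, Z (g ^+ n) & forall p, prime p -> (p %| n)%N -> relevant p].
Proof.
move=> Gg; have ex_n : exists n, (0 < n)%N && `[< Z (g ^+ n) >].
  by have [n n0 Zn] := power_fixed Gg; exists n; rewrite n0; apply/asboolP.
have [n /andP[n0 /asboolP Zn] n_min] := ex_minnP ex_n.
exists n; split=> // p p_pr p_n.
have nE : n = (n %/ p * p)%N by rewrite divnK.
have np0 : (0 < n %/ p)%N by rewrite divn_gt0 ?prime_gt0 // dvdn_leq.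
apply: (@relevant_of_fixed (g ^+ (n %/ p))) => //.
- exact: (subgrpX sG).
- move=> Znp; have /n_min : (0 < n %/ p)%N && `[< Z (g ^+ (n %/ p)) >].
    by rewrite np0; apply/asboolP.
  by rewrite leqNgt ltn_Pdiv ?prime_gt1.
- by rewrite -expgnA -nE.
Qed.

(** If [F] missed [x0], enlarge it to [N] maximal without [x0], so that [E / N] has order [p].
    Reading off the class modulo [N] as an exponent [i x], the automorphism [x |-> x * c ^+ i x]
    fixes [K] but moves [x0]. *)
Lemma relevant_frattini p : relevant p ->
  exists c, [/\ Z c, c <> 1, c ^+ p = 1 & forall F : set E, subgrp F -> F c ->
    [set` K] `<=` F -> (forall x, F (x ^+ p)) -> (forall x y, F [~ x, y]) ->
    forall x, F x].
Proof.
move=> [p_pr _ [c [Zc c1 cp]]]; exists c; split=> // F sF Fc KF Fp FR x0.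
apply: contrapT => Fx0.
have [|N [sN FN Nx0 maxN]] := @maximal_avoiding _ F [set x0] sF.
  by move=> x Fx xx0; apply: Fx0; rewrite -xx0.
have {}Nx0 : ~ N x0 by move=> /Nx0; apply.
have [N1 NM NV] := sN.
have nN : normal_in N by move=> y u Nu; rewrite conjg_mulR; apply/NM/FN/FR.
have p0 := prime_gt0 p_pr.
have XM x y n : N ((x ^+ n * y ^+ n)^-1 * (x * y) ^+ n).
  by apply: expgM_mod => //; apply/FN/FR.
have cN x y : N (x * y) -> N (y * x).
  by move=> /(nN x); rewrite /conjg !gnorm.
(* Maximality of [N] makes [x0] generate [E / N]: for [y] outside [N], [x0] is [y ^+ j] modulo [N],
   and [j] is invertible modulo [p]. *)
have repr y : exists i, N ((x0 ^+ i)^-1 * y).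
  have [Ny|Ny] := pselect (N y); first by exists 0%N; rewrite invg1 mul1g.
  pose B := [set z | exists j : nat, N ((y ^+ j)^-1 * z)].
  have sB : subgrp B.
    split=> [|u v [i Ni] [j Nj]|u [i Ni]].
    - by exists 0%N; rewrite invg1 mul1g.
    - exists (i + j)%N; rewrite expgnDr.
      have -> : (y ^+ i * y ^+ j)^-1 * (u * v) =
          ((y ^+ i)^-1 * u) ^ (y ^+ j) * ((y ^+ j)^-1 * v).
        by rewrite /conjg !gnorm.
      by apply: NM => //; apply: nN.
    - exists (i * p.-1)%N.
      have -> : (y ^+ (i * p.-1))^-1 * u^-1 =
          ((y ^+ (i * p))^-1 * (y ^+ i * u^-1)).
        rewrite -{2}(prednK p0) mulnS expgnDr invgM !mulgA.
        by rewrite mulgVK.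
      apply: NM; first by apply/NV; rewrite expgnA; apply/FN/Fp.
      by apply: cN; have := NV _ Ni; rewrite invgM invgK.
  have [j Nj] : B x0.
    apply: contrapT => Bx0; apply: Ny; apply: (maxN B) => //.
    - by move=> z Nz; exists 0%N; rewrite invg1 mul1g.
    - by move=> z Bz zx0; apply: Bx0; rewrite -zx0.
    - by exists 1%N; rewrite mulVg.
  have cpj : coprime j p.
    rewrite coprime_sym prime_coprime //; apply/negP => /dvdnP[i jE].
    apply: Nx0; rewrite -(mulVKg (y ^+ j) x0); apply: NM => //.
    by rewrite jE expgnA; apply/FN/Fp.
  have j0 : (0 < j)%N.
    rewrite lt0n; apply/eqP => j0; rewrite j0 in cpj.
    by move: cpj p_pr; rewrite /coprime gcd0n => /eqP ->.
  have /eqP gj := cpj.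
  have [l t ljE _] := egcdnP p j0; rewrite gj in ljE.
  exists l; set d := (y ^+ j)^-1 * x0 in Nj.
  have dE : x0 = y ^+ j * d by rewrite /d mulVKg.
  have := XM (y ^+ j) d l; rewrite -dE -expgnA mulnC ljE expgnDr expg1.
  set a := y ^+ (t * p); have Na : N a by rewrite /a expgnA; apply/FN/Fp.
  move=> /NV; rewrite invgM invgK => Nxl.
  have := NM _ _ Nxl (NV _ (subgrpX sN l Nj)).
  rewrite -[_ * _ / _]mulgA mulgK => Nay.
  have := NM _ _ Nay (NV _ (nN y _ Na)).
  by rewrite /conjg !gnorm.
have [i iP] := choice repr.
have x0X a : N (x0 ^+ a) -> (p %| a)%N.
  move=> Na; apply: contrapT => /negP; rewrite -prime_coprime // coprime_sym => cap.
  have [a0|a0] := posnP a.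
    by move: cap p_pr; rewrite a0 /coprime gcd0n => /eqP ->.
  have /eqP ga := cap; have [l t laE _] := egcdnP p a0; rewrite ga in laE.
  have := subgrpX sN l Na; rewrite -expgnA mulnC laE expgnDr expg1 => Nx.
  apply: Nx0; rewrite -(mulKg (x0 ^+ (t * p)) x0); apply: NM => //.
  by apply: NV; rewrite expgnA; apply/FN/Fp.
(* The exponent [i x] matters only modulo [p], so its properties are stated through powers of
   [c]. *)
have x0E a b : N ((x0 ^+ a)^-1 * x0 ^+ b) -> c ^+ a = c ^+ b.
  wlog le_ab : a b / (a <= b)%N => [hw|].
    have [/hw //|/ltnW/hw ba] := leqP a b.
    by move=> Nab; rewrite ba //; have := NV _ Nab; rewrite invgM invgK.
  rewrite -{1}(subnKC le_ab) expgnDr mulKg => /x0X/dvdnP[k kE].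
  by rewrite -(subnKC le_ab) expgnDr kE mulnC expgnA cp expg1n mulg1.
have cC x n : commute (c ^+ n) x.
  by apply/commute_sym/commuteX/commute_sym/fixed_central.
have iM x y : c ^+ i (x * y) = c ^+ i x * c ^+ i y.
  rewrite -expgnDr; apply: x0E.
  have -> : (x0 ^+ i (x * y))^-1 * x0 ^+ (i x + i y) =
      (x0 ^+ i (x * y))^-1 * (x * y) *
      (((x0 ^+ i x)^-1 * x) ^ (x0 ^+ i y) * ((x0 ^+ i y)^-1 * y))^-1.
    by rewrite expgnDr /conjg !gnorm.
  by apply: (NM) => //; apply: NV; apply: NM => //; apply: nN.
have iK x n : c ^+ i (x * c ^+ n) = c ^+ i x.
  apply: x0E; have -> : (x0 ^+ i (x * c ^+ n))^-1 * x0 ^+ i x =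
      (x0 ^+ i (x * c ^+ n))^-1 * (x * c ^+ n) * (((x0 ^+ i x)^-1 * x) * c ^+ n)^-1.
    by rewrite !gnorm.
  by apply: (NM) => //; apply: NV; apply: NM => //; apply: (subgrpX sN); apply: FN.
pose f x := x * c ^+ i x.
have fx0 : f x0 = x0.
  apply: rigid.
  - move=> x y; rewrite /f iM -!mulgA; congr (_ * _).
    by rewrite !mulgA (cC y).
  - apply: bijective_of_inj_surj => [x y fxy|y].
      have cxy : c ^+ i x = c ^+ i y by rewrite -(iK x (i x)) -/(f x) fxy iK.
      by move: fxy; rewrite /f cxy => /mulIg.
    exists (y * c ^+ (i y * p.-1)).
    by rewrite /f iK -mulgA -expgnDr -mulnSr prednK // mulnC expgnA cp expg1n mulg1.
  - by move=> x; rewrite /f mulKg; have [Gc _] := Zc; apply: (subgrpX sG).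
  - move=> k /KF/FN Nk; rewrite /f (_ : c ^+ i k = c ^+ 0) ?mulg1 //.
    apply: x0E; rewrite mulg1.
    have -> : (x0 ^+ i k)^-1 = (x0 ^+ i k)^-1 * k * k^-1 by rewrite mulgK.
    by apply: NM => //; apply: NV.
have : c ^+ i x0 = c ^+ 1 by apply: x0E; rewrite expg1; apply: iP.
rewrite expg1 => c_i; apply: c1; apply: (@mulgI _ x0).
by rewrite mulg1 -[RHS]fx0 /f c_i.
Qed.



(** Modulo [N], [R] is central and killed by [p], so all [p]-th powers and commutators of [E = K R]
    come from [K]; any [F] containing [K] and [N] contains them, and [relevant_frattini] applies. *)
Lemma relevant_generation (R N : set E) p : subgrp R -> subgrp N -> normal_in N ->
    (forall x : E, exists2 k, k \in K & exists2 r, R r & x = k * r) ->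
    relevant p -> (forall r, R r -> N (r ^+ p)) -> (forall r x, R r -> N [~ r, x]) ->
  exists c, [/\ Z c, c ^+ p = 1 & forall F : set E, subgrp F -> F c -> N `<=` F ->
    [set` K] `<=` F -> forall x, F x].
Proof.
move=> sR sN nN EKR rel_p Rp RR.
have [c [Zc _ cp cF]] := relevant_frattini rel_p.
exists c; split=> // F sF Fc NF KF; have [F1 FM FV] := sF.
apply: cF => // [x|x y].
  have [k Kk [r Rr ->]] := EKR x.
  rewrite -(mulVKg (k ^+ p * r ^+ p) (_ ^+ p)); apply: (FM).
    by apply: (FM); [apply: (subgrpX sF); apply: KF | apply/NF/Rp].
  by apply: NF; apply: (expgM_mod sN); [exact: nN | exact: nN | exact: RR].
have FJ a r : R r -> F a -> F (a ^ r).
  move=> Rr Fa; rewrite conjg_mulR -invgR; apply: (FM) => //.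
  by apply/FV/NF/RR.
have [k Kk [r Rr ->]] := EKR x; have [h Kh [s Rs ->]] := EKR y.
rewrite commgMl commgMr; apply: (FM); last exact/NF/RR.
apply: (FJ) => //; apply: (FM).
  by rewrite -invgR; apply/FV/NF/RR.
by apply: FJ => //; apply: (subgrpR sF); apply: KF.
Qed.

(** * Minimal normal supplements of [K] *)

Definition supplement (R : set E) : Prop :=
  [/\ subgrp R, normal_in R, Z `<=` R, R `<=` G &
    forall x : E, exists2 k, k \in K & exists2 r, R r & x = k * r].

(** Choose [R] with the fewest points of [K]. By [relevant_generation] the subgroup [S] generated by
    [Z], the [p]-th powers of [R] and [[R, E]] is again a supplement, so it has the same points of
    [K], and [E = K S] then forces [S = R]. *)
Lemma minimal_supplement : exists R, supplement R /\
  forall p W, relevant p -> subgrp W -> Z `<=` W -> (forall r, R r -> W (r ^+ p)) ->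
    (forall r x, R r -> W [~ r, x]) -> R `<=` W.
Proof.
pose cnt (R : set E) := count (fun k => `[< R k >]) K.
have ex_n : exists n, `[< exists2 R, supplement R & cnt R = n >].
  exists (cnt G); apply/asboolP; exists G => //; split=> // z [].
  by [].
have [n /asboolP[R supR cntR] n_min] := ex_minnP ex_n.
exists R; split=> // p W rel_p sW ZW Wp WR.
have [sR nR ZR RG EKR] := supR; have [R1 RM RV] := sR.
pose X := [set x | [\/ Z x, exists2 r, R r & x = r ^+ p |
  exists r y, R r /\ x = [~ r, y]]].
pose S := generated X.
have sS : subgrp S by exact: gen_subgrp.
have nS : normal_in S.
  apply: gen_normal => x y [Zx|[r Rr ->]|[r [z [Rr ->]]]].
  - by apply: Or31; apply: fixed_normal.
  - by apply: Or32; exists (r ^ y); [apply: (nR) | rewrite conjXg].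
  - by apply: Or33; exists (r ^ y), (z ^ y); split; [apply: (nR) | rewrite conjRg].
have ZS : Z `<=` S by move=> z Zz; apply: sub_gen; apply: Or31.
have SR : S `<=` R.
  apply: gen_min => // x [/ZR //|[r Rr ->]|[r [y [Rr ->]]]].
    exact: (subgrpX sR).
  by apply: (RM); [apply: (RV) | apply: (nR)].
have SW : S `<=` W.
  apply: gen_min => // x [/ZW //|[r Rr ->]|[r [y [Rr ->]]]].
    exact: Wp.
  exact: WR.
suff RS : R `<=` S by move=> r /RS/SW.
have [c [Zc _ cF]] := @relevant_generation R S p sR sS nS EKR rel_p
  (fun r Rr => sub_gen (Or32 _ _ (ex_intro2 _ _ r Rr erefl)))
  (fun r x Rr => sub_gen (Or33 _ _ (ex_intro _ r (ex_intro _ x (conj Rr erefl))))).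
have EKS x : exists2 k, k \in K & exists2 s, S s & x = k * s.
  apply: (cF _ (mul_subgrp sK sS nS)).
  - exists 1; first by case: sK.
    by exists c; [apply: ZS | rewrite mul1g].
  - move=> s Ss; exists 1; first by case: sK.
    by exists s => //; rewrite mul1g.
  - by move=> k Kk; exists k => //; exists 1; [case: sS | rewrite mulg1].
have /n_min le_n : `[< exists2 R', supplement R' & cnt R' = cnt S >].
  apply/asboolP; exists S => //; split=> //.
  by move=> s /SR/RG.
have KRS k : k \in K -> R k -> S k.
  move=> Kk Rk; apply: contrapT => Sk.
  suff : (cnt S < cnt R)%N by rewrite cntR ltnNge le_n.
  apply: (count_lt _ Kk) => [y /asboolP/SR Ry||]; first exact/asboolP.
    exact/asboolP.
  exact/asboolPn.
move=> r Rr; have [k Kk [s Ss rE]] := EKS r; rewrite rE.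
have [_ SM _] := sS; apply: (SM) => //; apply: KRS => //.
rewrite -(mulgK s k) -rE; apply: (RM) => //; exact/RV/SR.
Qed.

Lemma supplement_abelian R : supplement R ->
    (forall p W, relevant p -> subgrp W -> Z `<=` W -> (forall r, R r -> W (r ^+ p)) ->
      (forall r x, R r -> W [~ r, x]) -> R `<=` W) ->
  forall r s, R r -> R s -> commute r s.
Proof.
move=> [sR nR ZR RG EKR] Rgen; have [R1 RM RV] := sR.
(* [A] is the centre of [R]; below, [B] is its [p]-torsion and [T] the series of [K]-fixed layers of
   [B], which stops at some stage [c]. *)
pose A := R `&` [set a | forall r, R r -> commute r a].
have sA : subgrp A by apply: subgrpI => //; apply: subgrp_cent.
have [A1 AM AV] := sA.
have cA a r : A a -> R r -> commute a r by move=> [_ ca] Rr; apply/commute_sym/ca.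
have AR a : A a -> R a by case.
have nA : normal_in A.
  move=> x a Aa; split; first by apply: (nR); apply: AR.
  move=> r Rr; rewrite /commute -[r](conjgKV x) -!conjMg.
  by congr (_ ^ x); apply/commute_sym/cA => //; apply: (nR).
have ZA z : Z z -> A z.
  by move=> Zz; split; [apply: ZR | move=> r _; apply/commute_sym/fixed_central].
suff RA : R `<=` A by move=> r s /RA Ar Rs; apply: cA.
move=> x0 Rx0; apply: contrapT => Ax0.
have [n [n0 /ZA An n_rel]] := relevant_power (RG _ Rx0).
have [p [i [p_pr p_n Ai Aip]]] := prime_step n0 An Ax0.
have rel_p : relevant p by exact: n_rel.
pose B := [set b | A b /\ b ^+ p = 1].
have BA b : B b -> A b by case.
have cB b c : B b -> B c -> commute b c by move=> [Ab _] [/AR Rc _]; apply: cA.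
have sB : subgrp B.
  split=> [|b c Bb Bc|b [Ab bp]]; first by split=> //; rewrite expg1n.
    split; first by apply: (AM); apply: BA.
    by rewrite (expgMn _ (cB _ _ Bb Bc)) (proj2 Bb) (proj2 Bc) mulg1.
  by split; [apply: (AV) | rewrite expVgn bp invg1].
have nB y : normalized_by B y.
  by move=> b [Ab bp]; split; [apply: (nA) | rewrite -conjXg bp conj1g].
have n1 y : normalized_by [set 1 : E] y by move=> _ ->; rewrite /= conj1g.
pose T := layer K B [set 1].
have TB j b : T j b -> B b by apply: layer_sub => _ -> ; case: sB.
have sT j : subgrp (T j).
  apply: layer_subgrp => //; first exact: subgrp1.
have [c cT] : exists c, B `<=` T c.
  apply: (@layer_bounded _ Enil K sK B [set 1] sB (subgrp1) _ cB _ _ p) => //.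
  - by move=> _ ->; case: sB.
  - exact: prime_gt0.
  - by move=> b [].
(* Local nilpotency provides elements whose commutators with finitely many prescribed points lie in
   [A]. [Q j] says that for each [r] finitely many such conditions force [[~ g, r]] into [T j]; at
   [j = 0] they force [g] to commute with [r]. *)
pose good g (S : seq E) := [/\ R g, A (g ^+ p) & forall s, s \in S -> A [~ g, s]].
have good_sub g S S' : {subset S <= S'} -> good g S' -> good g S.
  by move=> SS' [Rg Agp gS']; split=> // s /SS'/gS'.
pose Q j := forall r, R r -> exists S, forall g, good g S -> T j [~ g, r].
have Qc : Q c.
  move=> r Rr; exists [:: r] => g [Rg Agp gr]; apply: cT.
  have Agr : A [~ g, r] by apply: gr; rewrite mem_head.
  split=> //; rewrite -commXg_cent; last exact: cA.
  by apply/eqP/commgP/cA.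
(* On [g] that are good for a large [S], the map [r |-> [~ g, r]] is multiplicative
   and [E]-equivariant, so on [p]-th powers and on [~ r, x] it drops one layer. *)
have QS j : Q j.+1 -> Q j.
  move=> QSj; pose W := [set r | R r /\ exists S, forall g, good g S -> T j [~ g, r]].
  have [T1 TM TV] := sT j.
  have TA b : T j b -> A b by move=> /TB/BA.
  have TE b r : T j b -> R r -> b ^ r = b.
    by move=> /TA Ab Rr; rewrite /conjg (cA _ _ Ab Rr) mulKg.
  suff RW : R `<=` W by move=> r /RW[].
  have sW : subgrp W.
    split=> [|r s [Rr [S SP]] [Rs [S' SP']]|r [Rr [S SP]]].
    - by split=> //; exists [::] => g _; rewrite commg1.
    - split; first exact: RM.
      exists (S ++ S') => g gSS; rewrite commgMr.
      have gS : good g S.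
        by apply: good_sub gSS => x Sx; rewrite mem_cat Sx.
      have gS' : good g S'.
        by apply: good_sub gSS => x Sx; rewrite mem_cat Sx orbT.
      by rewrite TE //; [apply: (TM); [apply: SP' | apply: SP] | apply: SP].
    - split; first exact: RV.
      exists S => g /SP Tgr.
      have -> : [~ g, r^-1] = ([~ g, r] ^ r^-1)^-1 by rewrite /commg /conjg !gnorm.
      by rewrite TE //; [apply: TV | apply: (RV)].
  apply: Rgen rel_p sW _ _ _ => [z Zz|r Rr|r x Rr].
  - split; first exact: ZR.
    exists [::] => g _; rewrite (_ : [~ g, z] = 1) //.
    by apply/eqP/commgP/commute_sym/fixed_central.
  - split; first exact: (subgrpX sR).
    have [S SP] := QSj r Rr; exists S => g /SP /TB [Agr grp].
    by rewrite commgX_cent ?grp //; apply: cA.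
  - split; first by apply: (RM); [apply: (RV) | apply: (nR)].
    have [S SP] := QSj r Rr; have [k Kk [s Rs xE]] := EKR x.
    (* With [[~ g, x^-1]] in [A], one gets [[~ g, r ^ x] = b ^ x] for [b = [~ g, r]]; hence [[~ g,
       [~ r, x]] = [~ b, x] = [~ b, k]], one layer lower. *)
    exists (x^-1 :: S) => g gxS.
    have [Rg Agp gS] := gxS.
    have Agx : A [~ g, x^-1] by apply: gS; rewrite mem_head.
    have Tb : T j.+1 [~ g, r].
      by apply: SP; apply: good_sub gxS => y Sy; rewrite inE Sy orbT.
    set b := [~ g, r] in Tb; have Ab : A b by apply/BA/TB/Tb.
    have gV : [~ g, r^-1] = b^-1.
      have -> : [~ g, r^-1] = (b ^ r^-1)^-1 by rewrite /b /commg /conjg !gnorm.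
      by rewrite /conjg (cA _ _ Ab (RV _ Rr)) mulKg.
    have gJ : [~ g, r ^ x] = b ^ x.
      have -> : [~ g, r ^ x] = [~ g * [~ g, x^-1], r] ^ x.
        by rewrite /commg /conjg !gnorm.
      have arE : [~ [~ g, x^-1], r] = 1 by apply/eqP/commgP/cA.
      rewrite commgMl arE mulg1 -/b /conjg.
      by rewrite (cA b [~ g, x^-1] Ab (AR _ Agx)) mulKg.
    have bsE : [~ b, s] = 1 by apply/eqP/commgP/cA.
    have Abk : A [~ b, k] by apply: (AM); [apply: (AV) | apply: (nA)].
    have -> : [~ g, [~ r, x]] = [~ b, k].
      rewrite (commgEl r x) commgMr gV gJ.
      have -> : b^-1 ^ (r ^ x) = b^-1.
        by rewrite /conjg (cA _ _ (AV _ Ab) (nR x r Rr)) mulKg.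
      have -> : b ^ x * b^-1 = [~ b, x].
        by rewrite commgEl; apply: (cA) (AR _ (AV _ Ab)); apply: (nA).
      rewrite xE commgMr bsE mul1g.
      by rewrite /conjg (cA _ _ Abk Rs) mulKg.
    by have [_] := Tb; apply.
have Q0 : Q 0%N by elim: c {cT} Qc => // j IHj /QS/IHj.
have [S0 S0P] : exists S, forall k, k \in K -> R k ->
    forall g, good g S -> [~ g, k] = 1.
  elim: (K : seq E) => [|k s [S SP]]; first by exists [::].
  have [Rk|Rk] := pselect (R k).
    have [S' SP'] := Q0 k Rk; exists (S' ++ S) => h.
    rewrite inE => /orP[/eqP ->|sh] Rh g gSS.
      by apply: SP'; apply: good_sub gSS => x Sx; rewrite mem_cat Sx.
    by apply: (SP) => //; apply: good_sub gSS => x Sx; rewrite mem_cat Sx orbT.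
  by exists S => h; rewrite inE => /orP[/eqP ->|sh] // Rh; apply: SP.
(* From [x0 ^+ i], local nilpotency leads to a point outside [A], of [p]-power order modulo [A],
   whose commutators with [S0 ++ K] lie in [A]; a power of it is the [g] that conjugates [R]. *)
pose M := [set x | R x /\ exists i, A (x ^+ (p ^ i))].
have [|x s [Rx [j Aj]] Ss||Ax0i|y [[Ry [j Ayj]] Ay AyS]] :=
    @last_outside _ Enil (S0 ++ K) M A (x0 ^+ i) => //.
- split; first by apply: (RM); [apply: (RV) | apply: (nR)].
  have xsA a : A a -> commute a x^-1 /\ commute a (x ^ s).
    by move=> Aa; split; apply: cA => //; [apply: (RV) | apply: (nR)].
  apply: (primary_mul Enil sA xsA).
    by exists j; rewrite expVgn; apply: (AV).
  by exists j; rewrite -conjXg; apply: (nA).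
- split; first exact: (subgrpX sR).
  by exists 1%N; rewrite expn1 -expgnA.
have pj0 : (0 < p ^ j)%N by rewrite expn_gt0 prime_gt0.
have [q [l [q_pr q_p Nl Al]]] := prime_step pj0 Ayj Ay.
have qp : q = p.
  by apply/eqP; rewrite -dvdn_prime2 //; move: q_p; rewrite Euclid_dvdX // => /andP[].
rewrite qp expgnA in Al; set g := y ^+ l in Nl Al.
have Rg : R g by exact: (subgrpX sR).
have gS s : s \in S0 ++ K -> A [~ g, s].
  move=> Ss; rewrite commXg_cent; first exact: (subgrpX sA _ (AyS s Ss)).
  by apply: cA => //; apply: AyS.
have gK k : k \in K -> A [~ g, k].
  by move=> Kk; apply: gS; rewrite mem_cat Kk orbT.
have gKR k : k \in K -> R k -> commute g k.
  move=> Kk Rk; apply/commgP/eqP; apply: S0P => //.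
  by split=> // s Ss; apply: gS; rewrite mem_cat Ss.
apply: Nl; split=> // r Rr; apply/commgP; rewrite -conjg_fix; apply/eqP.
apply: (@rigid_on [set` K] R (fun r => r ^ g)) => //.
- by move=> s Rs; apply: (nR).
- by move=> s t _ _; rewrite conjMg.
- by move=> s _ /eqP; rewrite conjg_eq1 => /eqP.
- by move=> s Rs; exists (s ^ g^-1); [apply: (nR) | rewrite conjgKV].
(* Equivariance: [g] and [k] commute up to [[~ k, g]] in [A], which acts trivially on [R]. *)
- move=> s k Rs Kk; rewrite -!conjgM commgC conjgM.
  have Akg : A [~ k, g] by rewrite -invgR; apply/AV/gK.
  have Rsgk : R (s ^ (g * k)) by apply: (nR).
  by rewrite /conjg -(cA _ _ Akg Rsgk) mulKg.
- by move=> k Kk Rk; rewrite /conjg -(gKR _ Kk Rk) mulKg.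
Qed.

(** * The abelian supplement and its divisible part *)

Section Abelian.
Context (D : set E) (supD : supplement D).
Context (cD : forall x y, D x -> D y -> commute x y).

Let sD : subgrp D. Proof. by case: supD. Qed.
Let nD : normal_in D. Proof. by case: supD. Qed.
Let DG : D `<=` G. Proof. by case: supD. Qed.
Let EKD : forall x : E, exists2 k, k \in K & exists2 d, D d & x = k * d.
Proof. by case: supD. Qed.

Let DXM n x y : D x -> D y -> (x * y) ^+ n = x ^+ n * y ^+ n.
Proof. by move=> Dx Dy; apply: expgMn; apply: cD. Qed.

Let DJ x y : D x -> D y -> x ^ y = x.
Proof. by move=> Dx Dy; rewrite /conjg (cD Dx Dy) mulKg. Qed.

(** Among the elements of [D] killed by [p], local nilpotency leads from [v] to a nontrivial one
    fixed by [K], that is, in [Z]. *)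
Lemma relevant_of_torsion v p : D v -> v <> 1 -> prime p -> (p %| m)%N -> v ^+ p = 1 ->
  relevant p.
Proof.
move=> Dv v1 p_pr p_m vp; have [D1 DM DV] := sD.
have [|x s [Dx xp] Ks|||y [[Dy yp] y1 yK]] :=
    @last_outside _ Enil K [set x | D x /\ x ^+ p = 1] [set 1] v => //.
  have Dxs : D (x ^ s) by apply: (nD).
  split; first by apply: (DM) => //; apply: (DV).
  rewrite DXM ?expVgn -?conjXg ?xp ?conj1g ?invg1 ?mulg1 //; exact: DV.
split=> //; exists y; split=> //; split; first exact: DG.
by move=> k Kk; apply/commgP/eqP; apply: yK.
Qed.

Let Pow p : set E :=
  generated [set x | (exists2 r, D r & x = r ^+ p) \/ exists r y, D r /\ x = [~ r, y]].

Let generators : exists c : nat -> E, forall p, relevant p ->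
  [/\ Z (c p), c p ^+ p = 1 & forall F : set E, subgrp F -> F (c p) -> Pow p `<=` F ->
    [set` K] `<=` F -> forall x, F x].
Proof.
suff ex p : exists c, relevant p ->
    [/\ Z c, c ^+ p = 1 & forall F : set E, subgrp F -> F c -> Pow p `<=` F ->
      [set` K] `<=` F -> forall x, F x].
  by have [c cP] := choice ex; exists c.
have [rel_p|nrel] := pselect (relevant p); last by exists 1.
have [||r Dr|r x Dr|c cP] := @relevant_generation D (Pow p) p sD _ _ EKD rel_p.
- exact: gen_subgrp.
- apply: gen_normal => x y [[r Dr ->]|[r [z [Dr ->]]]].
    by left; exists (r ^ y); [apply: nD | rewrite conjXg].
  by right; exists (r ^ y), (z ^ y); split; [apply: nD | rewrite conjRg].
- by apply: sub_gen; left; exists r.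
- by apply: sub_gen; right; exists r, x.
by exists c.
Qed.

(** [Q] is [K] enlarged by one central [c p] for each of the finitely many relevant primes. For such
    [p], every element of [D] is one of [Q] in [D] times one of [Pow p], that is, times [p]-th
    powers and commutators with [K]; the latter are removed layer by layer. *)
Lemma finite_supplement_mod_powers : exists Q : set E,
  [/\ [/\ subgrp Q, finite_set Q & [set` K] `<=` Q],
    forall x, Q x -> x ^+ m = 1,
    forall x, Q x -> exists2 k, k \in K & forall d, d ^ x = d ^ k &
    forall p d, relevant p -> D d ->
      exists2 x, Q x /\ D x & exists2 y, D y & d = x * y ^+ p].
Proof.
have [c cP] := generators; have [D1 DM DV] := sD; have sZ := fixed_subgrp.
pose S := [seq c p | p <- primes m & `[< relevant p >]].
have SP x : x \in S -> Z x /\ x ^+ m = 1.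
  case/mapP => p; rewrite mem_filter => /andP[/asboolP rel_p _] ->.
  have [Zc cp _] := cP p rel_p; split=> //.
  by have [_ /dvdnP[n ->] _] := rel_p; rewrite mulnC expgnA cp expg1n.
pose C := generated [set` S].
have sC : subgrp C by exact: gen_subgrp.
have CP x : C x -> Z x /\ x ^+ m = 1.
  move: x; apply: gen_min => //; have [Z1 ZM ZV] := sZ.
  split=> [|x y [Zx xm] [Zy ym]|x [Zx xm]].
  - by split=> //; rewrite expg1n.
  - split; first exact: ZM.
    by rewrite (expgMn _ (fixed_central y Zx)) xm ym mulg1.
  - by split; [apply: ZV | rewrite expVgn xm invg1].
have nC : normal_in C.
  by move=> y x Cx; rewrite /conjg (fixed_central y (proj1 (CP x Cx))) mulKg.
pose Q := [set x | exists2 k, [set` K] k & exists2 z, C z & x = k * z].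
have sQ : subgrp Q by exact: mul_subgrp.
have KQ : [set` K] `<=` Q.
  by move=> k Kk; exists k => //; exists 1; [case: sC | rewrite mulg1].
have CQ : C `<=` Q.
  by move=> z Cz; exists 1; [case: sK | exists z; rewrite ?mul1g].
exists Q; split=> //.
- split=> //; have finC : finite_set C.
    apply: finite_gen_torsion => // x /SP[_ xm]; by exists m.
  apply: sub_finite_set (finite_image2 (fun a b => a * b) (finite_seq K) finC).
  by move=> _ [k Kk [z Cz ->]]; exists k => //; exists z.
- move=> _ [k Kk [z /CP[Zz zm] ->]].
  by rewrite (expgMn _ (commute_sym (fixed_central k Zz))) Km // zm mulg1.
- move=> _ [k Kk [z /CP[Zz zm] ->]]; exists k => // d.
  by rewrite conjgM /conjg -(fixed_central _ Zz) mulKg.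
move=> p d rel_p Dd.
have [p_pr p_m _] := rel_p.
pose X := Q `&` D.
pose U := [set x | exists2 a, X a & exists2 y, D y & x = a * y ^+ p].
have sX : subgrp X by exact: subgrpI.
have XD : X `<=` D by move=> x [].
have [X1 XM XV] := sX.
have DX x : D x -> D (x ^+ p) by exact: (subgrpX sD).
have sU : subgrp U.
  split=> [|_ _ [a Xa [x Dx ->]] [b Xb [y Dy ->]]|_ [a Xa [x Dx ->]]].
  - by exists 1 => //; exists 1; rewrite ?expg1n ?mulg1.
  - exists (a * b); first exact: XM.
    exists (x * y); first exact: DM.
    rewrite DXM // -!mulgA; congr (_ * _); rewrite !mulgA; congr (_ * _).
    by apply: cD; [apply: (DX) | apply: XD].
  - exists a^-1; first exact: XV.
    exists x^-1; first exact: DV.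
    by rewrite invgM expVgn; apply: cD; [apply/DV/DX | apply/DV/XD].
have UD : U `<=` D.
  by move=> _ [a Xa [y Dy ->]]; apply: (DM); [apply: XD | apply: (DX)].
have nU k : k \in K -> normalized_by U k.
  move=> Kk _ [a [Qa Da] [y Dy ->]]; exists (a ^ k).
    by split; [apply: (subgrpJ sQ) => //; apply: KQ | apply: (nD)].
  by exists (y ^ k); [apply: (nD) | rewrite conjMg conjXg].
have DpU x : D x -> U (x ^+ p).
  by move=> Dx; exists 1 => //; exists x; rewrite ?mul1g.
have [j Lj] := @layer_bounded _ Enil K sK D U sD sU UD cD (fun k _ => nD k) nU
  p (prime_gt0 p_pr) DpU.
suff [] : U d by move=> a [Qa Da] [y Dy ->]; exists a => //; exists y.
(* If [layer j.+1] contains [D], then [layer j] contains [Pow p] and therefore [D]; [layer 0] is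
   [U]. *)
elim: j Lj => [|j IHj] Lj; first exact: Lj.
have [L1 LM LV] := @layer_subgrp _ K D U sD sU cD (fun k _ => nD k) j.
have UL : U `<=` layer K D U j by apply: layer_base.
apply: IHj => a Da.
have PowD : Pow p `<=` D.
  apply: gen_min => // x [[r Dr ->]|[r [y [Dr ->]]]]; first exact: DX.
  by apply: (DM); [apply: (DV) | apply: (nD)].
have PowL : Pow p `<=` layer K D U j.
  apply: gen_min => // x [[r Dr ->]|[r [y [Dr ->]]]]; first by apply/UL/DpU.
  have [k Kk [s Ds ->]] := EKD y; have [_ /(_ k Kk) Lrk] := Lj r Dr.
  have -> : [~ r, k * s] = [~ r, k].
    rewrite commgMr (_ : [~ r, s] = 1); last by apply/eqP/commgP/cD.
    by rewrite mul1g DJ //; apply: (DM); [apply: (DV) | apply: (nD)].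
  exact: Lrk.
have sPow : subgrp (Pow p) by exact: gen_subgrp.
have nPow : normal_in (Pow p).
  apply: gen_normal => x y [[r Dr ->]|[r [z [Dr ->]]]].
    by left; exists (r ^ y); [apply: (nD) | rewrite conjXg].
  by right; exists (r ^ y), (z ^ y); split; [apply: (nD) | rewrite conjRg].
have [Zc cp cF] := cP p rel_p.
have [x Qx [n Pn aE]] : exists2 x, Q x & exists2 n, Pow p n & a = x * n.
  apply: (cF _ (mul_subgrp sQ sPow nPow) _ _ _ a).
  - exists (c p); last by exists 1; [case: sPow | rewrite mulg1].
    apply: CQ; apply: sub_gen; apply/mapP; exists p => //.
    rewrite mem_filter mem_primes p_pr m_gt0 p_m !andbT.
    exact/asboolP.
  - move=> n Pn; exists 1; first by case: sQ.
    by exists n; rewrite ?mul1g.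
  - move=> k /KQ Qk; exists k => //; exists 1; first by case: sPow.
    by rewrite mulg1.
rewrite aE; apply: (LM); last exact: PowL.
apply: UL; exists x; last by exists 1; rewrite ?expg1n ?mulg1.
split=> //; rewrite -(mulgK n x) -aE; apply: (DM) => //; exact/DV/PowD.
Qed.

(** [N] is the part of [m] made of relevant primes, and [B] consists of the [N]-th powers in [D].
    Splitting off factors in [Q] prime by prime gives [E = Q B]. Since [N] kills the intersection of
    [Q] and [D], [d = x * z ^+ p] yields [d ^+ N = (z ^+ N) ^+ p]. *)
Lemma divisible_supplement : exists Q B : set E,
  [/\ [/\ subgrp Q, finite_set Q & [set` K] `<=` Q],
    forall x, Q x -> x ^+ m = 1,
    forall x, Q x -> exists2 k, k \in K & forall d, d ^ x = d ^ k,
    [/\ subgrp B, normal_in B, B `<=` D &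
      forall x, exists2 q, Q q & exists2 b, B b & x = q * b] &
    forall p b, relevant p -> B b -> exists2 b', B b' & b = b' ^+ p].
Proof.
have [Q [[sQ finQ KQ] Qm QJ Qpow]] := finite_supplement_mod_powers.
have [Q1 QM QV] := sQ; have [D1 DM DV] := sD.
have QI : subgrp (Q `&` D) by exact: subgrpI.
pose pi := [pred p | `[< relevant p >]].
pose N := (m`_pi)%N.
have Qpow_n n : (0 < n)%N -> (forall p, prime p -> (p %| n)%N -> relevant p) ->
    forall d, D d -> exists2 x, Q x /\ D x & exists2 y, D y & d = x * y ^+ n.
  elim/ltn_ind: n => n IHn n0 n_rel d Dd.
  have [n1|n1] := leqP n 1.
    have -> : n = 1%N by apply/eqP; rewrite eqn_leq n1.
    by exists 1 => //; exists d; rewrite ?mul1g.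
  have p_pr := pdiv_prime n1; have p_n := pdiv_dvd n.
  have [||q q_pr q_n|x [Qx Dx] [y Dy dE]] := IHn (n %/ pdiv n)%N _ _ _ d Dd.
  - by rewrite ltn_Pdiv ?prime_gt1.
  - by rewrite divn_gt0 ?prime_gt0 // dvdn_leq.
  - by apply: n_rel => //; apply: dvdn_trans q_n (dvdn_div p_n).
  have [x' [Qx' Dx'] [z Dz yE]] := Qpow _ y (n_rel _ p_pr p_n) Dy.
  exists (x * x' ^+ (n %/ pdiv n)).
    split; first by apply: QM => //; apply: (subgrpX sQ).
    by apply: (DM) => //; apply: (subgrpX sD).
  exists z => //; rewrite dE yE DXM //; last exact: (subgrpX sD).
  by rewrite -expgnA mulnC divnK // mulgA.
(* A nontrivial [x ^+ N] would have a power of prime order dividing the remaining part of [m], but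
   [relevant_of_torsion] makes that prime relevant. *)
have QN x : Q x -> D x -> x ^+ N = 1.
  move=> Qx Dx; apply: contrapT => xN1.
  have DxN i : D ((x ^+ N) ^+ i) by apply: (subgrpX sD); apply: (subgrpX sD).
  have [|p [i [p_pr p_m Ni Np]]] :=
      @prime_step _ [set 1] (x ^+ N) (m`_pi^')%N (part_gt0 _ _) _ xN1.
    by rewrite /= -expgnA partnC // Qm.
  have : p \in pi^' by apply: pnatP p_m; rewrite ?part_gt0 ?part_pnat.
  rewrite !inE => /asboolPn; apply; apply: (relevant_of_torsion (DxN i)) => //.
    exact: dvdn_trans p_m (dvdn_part _ _).
  by rewrite -expgnA.
have N0 : (0 < N)%N by exact: part_gt0.
have Nrel p : prime p -> (p %| N)%N -> relevant p.
  move=> p_pr p_N; apply/asboolP; change (p \in pi).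
  by apply: pnatP p_N => //; apply: part_pnat.
pose B := [set x | exists2 y, D y & x = y ^+ N].
exists Q, B; split=> //; [split|].
- split=> [|_ _ [x Dx ->] [y Dy ->]|_ [x Dx ->]].
  + by exists 1; rewrite ?expg1n.
  + by exists (x * y); [apply: (DM) | rewrite DXM].
  + by exists x^-1; [apply: (DV) | rewrite expVgn].
- by move=> x _ [y Dy ->]; exists (y ^ x); [apply: (nD) | rewrite conjXg].
- by move=> _ [y Dy ->]; apply: (subgrpX sD).
- move=> x; have [k Kk [d Dd ->]] := EKD x.
  have [q [Qq Dq] [y Dy ->]] := Qpow_n N N0 Nrel d Dd.
  exists (k * q); first by apply: QM => //; apply: KQ.
  by exists (y ^+ N); [exists y | rewrite mulgA].
- move=> p _ rel_p [y Dy ->]; have [x [Qx Dx] [z Dz ->]] := Qpow p y rel_p Dy.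
  exists (z ^+ N); first by exists z.
  rewrite DXM //; last exact: (subgrpX sD).
  by rewrite QN // mul1g expgnAC.
Qed.

(** The [p]-part [P] of [B] is divisible, so there is an equivariant [f : B -> P], a power map on
    [P]. By [rigid_on], [u x = x * f x ^+ n] is the identity, so [P] has bounded exponent, and a
    divisible [p]-group of bounded exponent is trivial. *)
Lemma divisible_torsion_free Q B p v : subgrp Q -> [set` K] `<=` Q ->
    (forall x, Q x -> x ^+ m = 1) ->
    (forall x, Q x -> exists2 k, k \in K & forall d, d ^ x = d ^ k) ->
    subgrp B -> normal_in B -> B `<=` D ->
    (forall x, exists2 q, Q q & exists2 b, B b & x = q * b) ->
    (forall b, B b -> exists2 b', B b' & b = b' ^+ p) ->
    prime p -> B v -> v ^+ p = 1 -> v = 1.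
Proof.
move=> sQ KQ Qm QJ sB nB BD EQB Bdiv p_pr Bv vp.
have [B1 BM BV] := sB; have p0 := prime_gt0 p_pr.
have cB x y : B x -> B y -> commute x y by move=> /BD Dx /BD Dy; apply: cD.
pose P := [set x | B x /\ exists i, x ^+ (p ^ i) = 1].
have PB : P `<=` B by move=> x [].
have sP : subgrp P.
  split=> [|x y [Bx [i xi]] [By [j yj]]|x [Bx [i xi]]].
  - by split=> //; exists 0%N.
  - split; first exact: BM.
    exists (i + j)%N; rewrite (expgMn _ (cB _ _ Bx By)) expnD.
    by rewrite expgnA xi mulnC expgnA yj !expg1n mulg1.
  - by split; [apply: BV | exists i; rewrite expVgn xi invg1].
have nP : normal_in P.
  by move=> y x [Bx [i xi]]; split; [apply: nB | exists i; rewrite -conjXg xi conj1g].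
have Pdivp x : P x -> exists2 y, P y & x = y ^+ p.
  move=> [Bx [i xi]]; have [y By xE] := Bdiv x Bx; exists y => //.
  by split=> //; exists i.+1; rewrite expnS expgnA -xE.
have Pdiv q x : prime q -> P x -> exists2 y, P y & x = y ^+ q.
  move=> q_pr Px; have [->|qp] := eqVneq q p; first exact: Pdivp.
  have [_ [i xi]] := Px.
  have [|l lE] := expg_coprime_root (prime_gt0 q_pr) _ xi.
    by rewrite coprimeXl // prime_coprime // dvdn_prime2 // eq_sym.
  by exists (x ^+ l) => //; apply: (subgrpX sP).
have [f [s s0 [fP fM fid fJ]]] := equivariant_retraction sB sP PB cB Pdiv sK nB nP.
have [P1 PM PV] := sP.
(* The factor [m] makes [u] the identity on the intersection of [Q] and [B]; the factor [p] makes
   [1 + s * n] prime to [p], so that [u] is bijective on [P]. *)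
pose n := (m * p)%N; have n0 : (0 < n)%N by rewrite muln_gt0 m_gt0.
have f1 : f 1 = 1 by rewrite fid // expg1n.
have fX x i : B x -> f (x ^+ i) = f x ^+ i.
  move=> Bx; elim: i => [|i IHi]; first by rewrite !expg0.
  by rewrite !expgS fM ?IHi //; apply: (subgrpX sB).
have fXP x i : B x -> P (f x ^+ i) by move=> Bx; apply: (subgrpX sP); apply: fP.
have cop i : coprime (p ^ i) (1 + s * n).
  apply: coprimeXl; rewrite prime_coprime // /n mulnA dvdn_addl ?dvdn_mull //.
  by rewrite Euclid_dvd1.
pose u x := x * f x ^+ n.
have uP x : P x -> u x = x ^+ (1 + s * n).
  by move=> Px; rewrite /u fid // expgnDr expg1 expgnA.
have uM x y : B x -> B y -> u (x * y) = u x * u y.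
  move=> Bx By; rewrite /u fM // (expgMn _ (cB _ _ (PB _ (fP _ Bx)) (PB _ (fP _ By)))).
  rewrite -!mulgA; congr (_ * _); rewrite !mulgA; congr (_ * _).
  by apply: cB => //; apply/PB/fXP.
have u_id x : B x -> u x = x.
  apply: (rigid_on sQ sB nB _ KQ EQB) => //.
  - by move=> y /BD/DG.
  - by move=> y By; apply: (BM) => //; apply/PB/fXP.
  - move=> y By uy; have yE : y = (f y ^+ n)^-1.
      by rewrite -[RHS]mul1g -uy /u mulgK.
    have Py : P y by rewrite yE; apply/PV/fXP.
    have [_ [i yi]] := Py; move: uy; rewrite uP // => uy.
    by apply: expg_coprime (cop i) yi uy; rewrite expn_gt0 p0.
  (* The preimage of [y] is [y] times a [(1 + s * n)]-th root of [(f y ^+ n)^-1], which exists in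
     [P] by coprimality. *)
  - move=> y By; have Pw : P (f y ^+ n)^-1 by apply/PV/fXP.
    have [_ [i wi]] := Pw.
    have sn1 : (0 < 1 + s * n)%N by [].
    have [l lE] := expg_coprime_root sn1 (cop i) wi.
    have Pl : P (((f y ^+ n)^-1) ^+ l) by apply: (subgrpX sP).
    exists (y * ((f y ^+ n)^-1) ^+ l); first by apply: (BM) => //; apply: PB.
    by rewrite uM //; [rewrite (uP _ Pl) lE /u mulgK | apply: PB].
  - move=> y q By Qq; have [k Kk qk] := QJ q Qq.
    by rewrite !qk /u conjMg conjXg fJ.
  - by move=> y Qy By; rewrite /u /n expgnA -fX // Qm // f1 expg1n mulg1.
have Ptriv x : P x -> x ^+ (s * n) = 1.
  move=> Px; have := u_id x (PB _ Px); rewrite uP // expgnDr expg1.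
  by rewrite -[RHS]mulg1 => /mulgI.
have Pv : P v by split=> //; exists 1%N.
have Ppow i x : P x -> exists2 y, P y & x = y ^+ (p ^ i).
  elim: i x => [|i IHi] x Px; first by exists x.
  have [y Py ->] := IHi x Px; have [z Pz ->] := Pdivp y Py.
  by exists z => //; rewrite expnS expgnA.
have sn0 : (0 < s * n)%N by rewrite muln_gt0 s0.
(* With [b] the part of [s * n] prime to [p], [v ^+ b] is an [(s * n)]-th power in [P], hence
   trivial; as [v ^+ p = 1] too, [v] is trivial. *)
have [y Py vE] := Ppow (logn p (s * n)) v Pv.
have [b cpb snE] := pfactor_coprime p_pr sn0.
apply: (expg_coprime p0 cpb vp).
by rewrite vE -expgnA mulnC -snE; apply: Ptriv.
Qed.

(* Evenness of [m] makes 2 relevant as soon as [B] has an involution; without it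
   inversion could be the identity. *)
Lemma finite_of_abelian : (2 %| m)%N -> finite_set [set: E].
Proof.
move=> m2; have [Q [B [[sQ finQ KQ] Qm QJ [sB nB BD EQB] Bdiv]]] := divisible_supplement.
have [B1 BM BV] := sB.
have Btf p v : relevant p -> B v -> v ^+ p = 1 -> v = 1.
  move=> rel_p; have [p_pr _ _] := rel_p.
  apply: (divisible_torsion_free sQ KQ Qm QJ sB nB BD EQB _ p_pr) => b Bb.
  exact: Bdiv rel_p Bb.
have BX v i : B v -> B (v ^+ i) by exact: (subgrpX sB).
have Bmtf v : B v -> v ^+ m = 1 -> v = 1.
  move=> Bv vm; apply: contrapT => v1.
  have [p [i [p_pr p_m vi vip]]] := @prime_step _ [set 1] _ _ m_gt0 vm v1.
  rewrite /= expgnA in vip; apply: (vi); apply: (Btf p) => //; last exact: BX.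
  exact: (relevant_of_torsion (BD _ (BX v i Bv))).
have BZ b : B b -> Z b.
  move=> Bb; have Gb := DG (BD _ Bb); split=> // k Kk; apply/commgP/eqP.
  apply: contrapT => bk1; have [n [n0 Zbn n_rel]] := relevant_power Gb.
  have Bbk : B [~ b, k] by apply: (BM); [apply: (BV) | apply: (nB)].
  have bkn : [~ b, k] ^+ n = 1.
    rewrite -commXg_cent; last by apply: cD; apply: BD.
    by apply/eqP/commgP/fixed_central.
  have [p [i [p_pr p_n vi vip]]] := @prime_step _ [set 1] _ _ n0 bkn bk1.
  rewrite /= expgnA in vip; apply: (vi); apply: (Btf p) => //; last exact: BX.
  exact: n_rel.
have inv_id b : B b -> b^-1 = b.
  apply: (rigid_on (u := fun b => b^-1) sQ sB nB _ KQ EQB).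
  - by move=> x /BD/DG.
  - exact: BV.
  - by move=> x y Bx By; rewrite invgM; apply: cD; apply: BD; apply: (BV).
  - by move=> x _ x1; rewrite -[x]invgK x1 invg1.
  - by move=> x Bx; exists x^-1; [apply: (BV) | rewrite invgK].
  - by move=> x q _ _; rewrite conjVg.
  - by move=> x Qx Bx; rewrite (Bmtf x Bx (Qm x Qx)) invg1.
have Btriv b : B b -> b = 1.
  move=> Bb; apply: Bmtf => //; have /dvdnP[l ->] := m2.
  by rewrite mulnC expgnA expg2 -{1}(inv_id b Bb) mulVg expg1n.
apply: sub_finite_set finQ => x _; have [q Qq [b Bb ->]] := EQB x.
by rewrite (Btriv b Bb) mulg1.
Qed.

End Abelian.

Lemma finite_of_rigid : (2 %| m)%N -> finite_set [set: E].
Proof.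
move=> m2; have [R [supR Rgen]] := minimal_supplement.
exact: finite_of_abelian supR (supplement_abelian supR Rgen) m2.
Qed.

End Rigidity.

(** * The semidirect product *)

Lemma finite_subgrp_torsion (E : groupType) (A : set E) : subgrp A -> finite_set A ->
  forall x, A x -> torsion x.
Proof.
move=> sA /finite_seqP[s As] x Ax.
pose t := [seq x ^+ i | i <- iota 0 (size s).+1].
have ts : {subset t <= s}.
  move=> _ /mapP[i _ ->]; have : A (x ^+ i) by exact: (subgrpX sA).
  by rewrite As.
have /(uniqPn 1)[i [j [lt_ij]]] : ~~ uniq t.
  by apply/negP => /uniq_leq_size/(_ ts); rewrite size_map size_iota ltnn.
rewrite size_map size_iota => lt_j.
rewrite !(nth_map 0%N) ?size_iota ?(ltn_trans lt_ij) // !nth_iota ?(ltn_trans lt_ij) //.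
rewrite !add0n => xij; exists (j - i)%N; first by rewrite subn_gt0.
by rewrite expgnFr ?(ltnW lt_ij) // xij mulgV.
Qed.

Section Semidirect.
Context {G : groupType} (Gam : subgroup (aut G)).
Local Notation E := (semidirect Gam).

Definition sd_inl (x : G) : E := @SDProd _ _ val x 1.
Definition sd_inr (a : subgroup_type Gam) : E := @SDProd _ _ val 1 a.

Lemma sd_inlM : {morph sd_inl : x y / x * y}.
Proof. by move=> x y; congr SDProd; rewrite /= ?mulg1. Qed.

Lemma sd_inrM : {morph sd_inr : a b / a * b}.
Proof. by move=> a b; congr SDProd; rewrite /= sd_aut1 mulg1. Qed.

Lemma sd_rightM (u v : E) : sd_right (u * v) = sd_right u * sd_right v.
Proof. by []. Qed.

Lemma sd_rightV (u : E) : sd_right u^-1 = (sd_right u)^-1.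
Proof. by []. Qed.

Lemma sd_inlP (u : E) : sd_right u = 1 -> u = sd_inl (sd_left u).
Proof. by case: u => x a /= ->. Qed.

Lemma sd_inr_inl a x : sd_inr a * sd_inl x = sd_inl (val a x) * sd_inr a.
Proof.
by congr SDProd; rewrite /= ?mul1g ?mulg1.
Qed.

Lemma sd_kernel_subgrp : subgrp [set u : E | sd_right u = 1].
Proof.
split=> // [u v u1 v1|u u1].
  by transitivity (sd_right u * sd_right v) => //; rewrite u1 v1 mulg1.
by transitivity (sd_right u)^-1 => //; rewrite u1 invg1.
Qed.

Lemma sd_kernel_normal : normal_in [set u : E | sd_right u = 1].
Proof.
by move=> v u u1; transitivity (sd_right u ^ sd_right v) => //; rewrite u1 conj1g.
Qed.

Lemma sd_inr_subgrp : subgrp (range sd_inr).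
Proof.
have inrV a : sd_inr a^-1 = (sd_inr a)^-1.
  apply: (@mulgI _ (sd_inr a)); rewrite -sd_inrM !mulgV.
  by [].
split=> [|_ _ [a _ <-] [b _ <-]|_ [a _ <-]].
- by exists 1.
- by exists (a * b) => //; apply: sd_inrM.
- by exists a^-1.
Qed.

(** Generation of [Gam] is stated inside [aut G]; [Y] pulls the group generated by the lifts in [E]
    back there, where it contains the generators [L]. *)
Lemma sd_inr_generated : finitely_generated Gam ->
  exists2 S : seq E, [set` S] `<=` range sd_inr & range sd_inr `<=` generated [set` S].
Proof.
case=> X /finite_seqP[L ->] genL.
exists [seq sd_inr a | a <- pmap insub L].
  by move=> _ /mapP[a _ ->]; exists a.
set S := [seq _ | _ <- _]; have [g1 gM gV] := gen_subgrp [set` S].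
pose Y := [set f | exists2 a : subgroup_type Gam,
  val a = f & generated [set` S] (sd_inr a)].
have [_ _ rV] := sd_inr_subgrp.
have sY : subgrp Y.
  split=> [|_ _ [a <- ga] [b <- gb]|_ [a <- ga]].
  - by exists 1.
  - by exists (a * b) => //; rewrite sd_inrM; apply: gM.
  - exists a^-1 => //.
    have -> : sd_inr a^-1 = (sd_inr a)^-1.
      apply: (@mulgI _ (sd_inr a)); rewrite -sd_inrM !mulgV.
      by [].
    exact: gV.
move=> _ [a _ <-]; suff [b /val_inj -> //] : Y (val a).
suff GY : generated [set` L] `<=` Y.
  by apply: GY; rewrite genL; apply: set_mem; apply: (valP a).
apply: gen_min => // f Lf.
have Gf : f \in (Gam : set _) by apply: mem_set; rewrite -genL; apply: sub_gen.
exists (SubgroupElt Gf) => //; apply: sub_gen; apply/mapP; exists (SubgroupElt Gf) => //.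
by rewrite mem_pmap_sub.
Qed.

End Semidirect.

(** * The basis hypothesis turned into rigidity of [E] *)

Theorem theorem3p4 (G : groupType) (Gam : subgroup (aut G)) (H : subgroup G)
    (Gam_fg : finitely_generated Gam)
    (E_locnil : locally_nilpotent (semidirect Gam))
    (H_fin : finite_set H)
    (H_basis : delta_basis (@aut_fun G @` aut_centralizer Gam) H) :
  finite_set [set: semidirect Gam].
Proof.
pose E := semidirect Gam.
have basis1 f : aut_centralizer Gam f -> (forall h, (H : set G) h -> f h = h) -> f = 1.
  move=> cf fH; apply: autP => x.
  have -> : aut_fun f = aut_fun (1 : aut G); last by [].
  apply: H_basis => [||h /set_mem Hh]; last exact: fH.
    by exists f.
  by exists 1 => // c _; apply/commute_sym/commute1.
have [S SG GS] := sd_inr_generated Gam_fg.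
have [T TE] : exists T : seq E, [set` T] = sd_inl Gam @` H.
  by have /finite_seqP[T TE] := finite_image (sd_inl Gam) H_fin; exists T.
have Ttor h : h \in T -> torsion (h : E).
  move=> Th; have [x Hx <-] : (sd_inl Gam @` H) h by rewrite -TE.
  have [n n0 xn] := finite_subgrp_torsion (subgroupP H) H_fin Hx.
  exists n => //.
  have inlX i : sd_inl Gam x ^+ i = sd_inl Gam (x ^+ i) :> E.
    by elim: i => [|i IHi] //; rewrite !expgS sd_inlM IHi.
  by rewrite inlX xn.
have cent_gen (u : E) : (forall s, s \in S -> commute u s) ->
    forall a, commute u (sd_inr a).
  move=> cS a; suff sub : generated [set` S] `<=`
      [set v | forall w, (forall s, s \in S -> commute w s) -> commute w v].
    by apply: sub => //; apply: GS; exists a.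
  apply: gen_min; first exact: subgrp_cent.
  by move=> s Ss w; apply.
(* Commuting with [S] means centralizing [Gam], and commuting in [E] with the image of [h] means
   fixing [h], so [basis1] applies. *)
have fix1 (a : subgroup_type Gam) : (forall s, s \in S -> commute (sd_inr a) s) ->
    (forall h, h \in T -> commute (sd_inr a) h) -> a = 1.
  move=> cS cT; apply: val_inj; apply: basis1 => [c Gc|h Hh].
    pose b := SubgroupElt (mem_set Gc).
    have /(congr1 (fun u : E => val (sd_right u))) := cent_gen _ cS b.
    by [].
  have Th : sd_inl Gam h \in T.
    by have : [set` T] (sd_inl Gam h : E) by rewrite TE; exists h.
  have := cT _ Th; rewrite /commute sd_inr_inl.
  move/(congr1 (fun u : E => sd_left u)) => /=.
  by rewrite !mulg1.
have central_torsion (u : E) : range (@sd_inr _ Gam) u ->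
    (forall s, s \in S -> commute u s) -> torsion u.
  move=> ru cS; have [h Th|n n0 nT] := @power_commutes _ E_locnil u T.
    by apply: torsionRr => //; apply: Ttor.
  exists n => //; have [a _ aE] : range (@sd_inr _ Gam) (u ^+ n).
    exact: (subgrpX (sd_inr_subgrp Gam)).
  rewrite -aE (fix1 a) // => s Ss; rewrite aE; last exact: nT.
  by apply/commute_sym/commuteX/commute_sym/cS.
(* A last non-torsion [y] has torsion commutators with [S], so a power of it centralizes [Gam] and
   is torsion by [central_torsion], a contradiction. *)
have Gam_torsion (u : E) : range (@sd_inr _ Gam) u -> torsion u.
  move=> ru; apply: contrapT => u_nt; have sG := sd_inr_subgrp Gam.
  have [|y s ry Ss|||y [ry y_nt yS]] :=
      @last_outside _ E_locnil S (range (@sd_inr _ Gam)) (@torsion _) u => //.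
  - by exists 1%N.
  - by apply: (subgrpR sG) => //; apply: SG.
  have [n n0 nS] := power_commutes E_locnil yS.
  have [k k0 yk] := central_torsion _ (subgrpX sG n ry) nS.
  by apply: y_nt; exists (n * k)%N; rewrite ?muln_gt0 ?n0 // expgnA.
have gtor s : s \in T ++ S -> torsion (s : E).
  by rewrite mem_cat => /orP[/Ttor //|/SG/Gam_torsion].
(* [K] lists the group [<H, Gam>]. *)
have /finite_seqP[K KE] := finite_gen_torsion E_locnil gtor.
have sK : subgrp [set` K] by rewrite -KE; apply: gen_subgrp.
have TK h : h \in T -> h \in K.
  move=> Th; have : [set` K] h; last by [].
  by rewrite -KE; apply: sub_gen; rewrite /= mem_cat Th.
have GK a : sd_inr a \in K.
  have : [set` K] (sd_inr a : E); last by [].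
  rewrite -KE; suff : generated [set` S] `<=` generated [set` T ++ S].
    by apply; apply: GS; exists a.
  apply: gen_min => [|s Ss]; first exact: gen_subgrp.
  by apply: sub_gen; rewrite /= mem_cat Ss orbT.
have [m m0 Km] : exists2 m, (0 < m)%N & forall k, k \in K -> (k : E) ^+ m = 1.
  apply: (@common_exponent _ K id) => k Kk; apply: (gen_torsion E_locnil gtor).
  by rewrite KE.
have EKG (x : E) : exists2 k, k \in K & exists2 g, sd_right g = 1 & x = k * g.
  exists (sd_inr (sd_right x)) => //.
  exists ((sd_inr (sd_right x))^-1 * x); last by rewrite mulVKg.
  by rewrite sd_rightM sd_rightV mulVg.
(* The exponent is doubled because [finite_of_rigid] asks for an even one. *)
have m20 : (0 < m * 2)%N by rewrite muln_gt0 m0.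
have Km2 k : k \in K -> (k : E) ^+ (m * 2) = 1.
  by move=> Kk; rewrite expgnA Km // expg1n.
apply: (finite_of_rigid E_locnil (sd_kernel_subgrp Gam) (@sd_kernel_normal _ Gam)
  sK EKG m20 Km2); last by rewrite dvdn_mull.
move=> f fM f_bij fG fK.
have right1 (u : E) : sd_right (f u) = sd_right u.
  have : (sd_right u)^-1 * sd_right (f u) = 1 := fG u.
  by move/mulg1_eq; rewrite invgK.
(* Being trivial modulo [G], [f] restricts to a map [al] of [G]. As [f] fixes [K], [al] commutes
   with [Gam] and fixes [H], so it is the identity by the basis hypothesis. *)
pose al x := sd_left (f (sd_inl Gam x)).
have f_inl x : f (sd_inl Gam x) = sd_inl Gam (al x) by apply: sd_inlP; rewrite right1.
have inl_inj : injective (sd_inl Gam) by move=> x y [].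
have alM : {morph al : x y / x * y}.
  by move=> x y; apply: inl_inj; rewrite sd_inlM -!f_inl sd_inlM fM.
have al_bij : bijective al.
  apply: bijective_of_inj_surj => [x y xy|y].
    by apply/inl_inj/(bij_inj f_bij); rewrite !f_inl xy.
  have [g fg gf] := f_bij; exists (sd_left (g (sd_inl Gam y))).
  apply: inl_inj; rewrite -f_inl -sd_inlP ?gf //.
  by rewrite -right1 gf.
pose alm : {multiplicative G -> G} := HB.pack al (isMultiplicative.Build G G al alM).
pose ala : aut G := @Aut G alm al_bij.
have ala1 : ala = 1.
  apply: basis1 => [c Gc|h Hh].
    apply: autP => x; change (al (c x) = c (al x)).
    pose a := SubgroupElt (mem_set Gc).
    apply: inl_inj; rewrite -f_inl.
    apply: (@mulIg _ (sd_inr a)); rewrite -[in RHS](sd_inr_inl a).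
    by rewrite -{1}(fK (sd_inr a)) // -fM -(sd_inr_inl a) fM fK // f_inl.
  apply: inl_inj; change (sd_inl Gam (al h) = sd_inl Gam h :> E).
  rewrite -f_inl; apply: fK.
  apply: TK; have : [set` T] (sd_inl Gam h : E); last by [].
  by rewrite TE; exists h.
have al1 x : al x = x by rewrite -[al x]/(ala x) ala1.
move=> x; have [k Kk [g g1 ->]] := EKG x.
by rewrite fM fK // (sd_inlP g1) f_inl al1.
Qed.
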